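(* Let $G$ be a connected graph and let $U \subseteq V(G)$. Then $U$ is normally spanned in $G$ if and only if every $U$-rooted minor of $G$ has countable colouring number.
   Context: A rooted tree $T \subseteq G$ (with tree order $x \le y$ iff $x$ lies on the path in $T$ from the root to $y$) is normal in $G$ if for every $T$-path $P$ in $G$ (a path with at least one edge whose two endvertices lie in $T$ and whose edges and inner vertices lie outside $T$) the endvertices of $P$ are comparable in the tree order. A set $U \subseteq V(G)$ is normally spanned in $G$ if there is a normal tree $T$ in $G$ with $U \subseteq V(T)$. A minor $H$ of $G$ is given by disjoint connected branch sets $X_v \subseteq V(G)$ ($v \in V(H)$), with $vw \in E(H)$ only if there is an edge of $G$ between $X_v$ and $X_w$; it is $U$-rooted if every branch set contains a vertex of $U$. A graph has countable colouring number if its vertex set admits a well-order in which every vertex is preceded by only finitely many of its neighbours. *)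

(* Defs.v *)
From Stdlib Require Import List Relations.
Import ListNotations.
Set Implicit Arguments.

Section Graphs.
Variable V : Type.

Fixpoint chain (e : V -> V -> Prop) (l : list V) : Prop :=
  match l with
  | x :: ((y :: _) as t) => e x y /\ chain e t
  | _ => True
  end.

Definition is_path (e : V -> V -> Prop) (a b : V) (l : list V) : Prop :=
  NoDup (a :: l) /\ chain e (a :: l) /\ last (a :: l) a = b.

Definition connected_in (e : V -> V -> Prop) (X : V -> Prop) : Prop :=
  (exists x, X x) /\
  forall x y, X x -> X y ->
    clos_refl_trans V (fun a b => e a b /\ X a /\ X b) x y.

Definition simple_graph (adj : V -> V -> Prop) : Prop :=
  (forall x y, adj x y -> adj y x) /\ (forall x, ~ adj x x).

Definition graph_connected (adj : V -> V -> Prop) : Prop :=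
  connected_in adj (fun _ => True).

Definition rooted_tree (adj : V -> V -> Prop)
    (VT : V -> Prop) (ET : V -> V -> Prop) (r : V) : Prop :=
  (forall x y, ET x y -> adj x y /\ VT x /\ VT y) /\
  (forall x y, ET x y -> ET y x) /\
  VT r /\
  connected_in ET VT /\
  (forall a b l, 2 <= length l -> is_path ET a b l -> ~ ET b a).

Definition tree_le (ET : V -> V -> Prop) (r x y : V) : Prop :=
  exists l, is_path ET r y l /\ In x (r :: l).

Definition T_path (adj : V -> V -> Prop) (VT : V -> Prop) (ET : V -> V -> Prop)
    (a b : V) (inner : list V) : Prop :=
  is_path (fun x y => adj x y /\ ~ ET x y) a b (inner ++ [b]) /\
  VT a /\ VT b /\ (forall v, In v inner -> ~ VT v).

Definition normal_tree (adj : V -> V -> Prop)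
    (VT : V -> Prop) (ET : V -> V -> Prop) (r : V) : Prop :=
  rooted_tree adj VT ET r /\
  forall a b inner, T_path adj VT ET a b inner ->
    tree_le ET r a b \/ tree_le ET r b a.

Definition normally_spanned (adj : V -> V -> Prop) (U : V -> Prop) : Prop :=
  exists VT ET r, normal_tree adj VT ET r /\ forall u, U u -> VT u.

End Graphs.

Definition is_minor (V W : Type) (adj : V -> V -> Prop)
    (adjH : W -> W -> Prop) (X : W -> V -> Prop) : Prop :=
  simple_graph adjH /\
  (forall v w x, v <> w -> X v x -> X w x -> False) /\
  (forall w, connected_in adj (X w)) /\
  (forall v w, adjH v w -> exists x y, X v x /\ X w y /\ adj x y).

Definition U_rooted (V W : Type) (U : V -> Prop) (X : W -> V -> Prop) : Prop :=
  forall w, exists u, U u /\ X w u.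

Definition countable_colouring_number (W : Type) (adjH : W -> W -> Prop) : Prop :=
  exists R : W -> W -> Prop,
    (forall x, ~ R x x) /\
    (forall x y z, R x y -> R y z -> R x z) /\
    (forall x y, R x y \/ x = y \/ R y x) /\
    well_founded R /\
    (forall w, exists l : list W, forall u, adjH u w -> R u w -> In u l).

(* Main.v *)
(** If [U] lies in a normal tree, then every branch set of a [U]-rooted minor has a least vertex
in the tree order. Adjacent branch sets have comparable least vertices, and every vertex has only
finitely many predecessors, so ordering the branch sets by the height of these vertices proves
that the colouring number is countable.

For the converse, well-order [V] and recursively choose disjoint countable connected sets [K u],
each containing [u], that cover [U]: the set [K u] lives in the component [D u] of [u] in the
complement of the earlier sets, and has infinitely many neighbours among these whenever [D u]
does. Say that [w] is below [u] if [w] precedes [u] and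
[K u] lies in [D w]. Contracting the sets [K u] gives a
[U]-rooted minor; its countable colouring number orients it with finite out-degrees. A closing-off
argument then shows that every chain is countable, and another minor shows that only countably
many [K v] have infinitely many neighbours in a given [K u]. Hence each [u] generates a countable
set closed under passing to indices below, to out-neighbours, and to such [v]. For a closed set of
indices, the corresponding union [S] has finite adhesion: every component of its complement that
meets some [K u] has only finitely many neighbours in [S], as a least counterexample would be
joined to [S] by an edge oriented away from [S].

Enumerating the closed sets one after another well-orders the union [X] of all [K u] so that every
proper initial segment is, up to finitely many vertices, such a set [S]. A normal tree containing
[X] is now built by transfinite recursion. Every vertex of the tree constructed before stage [x] lies
below a vertex of the initial segment before [x], so the component of [x] outside the tree still
has only finitely many neighbours. They form a chain in the tree, and a path from the top of this
chain to [x] can be added. *)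

Require Import Defs.
From Stdlib Require Import List Relations Wellfounded Wf_nat Arith Lia Cantor.
From mathcomp Require eqtype boolp wochoice.
From Stdlib Require Import Classical ClassicalEpsilon FunctionalExtensionality PropExtensionality.
Import ListNotations.
Set Implicit Arguments.
Unset Strict Implicit.

(** * Well-orders and recursion with choice *)

Definition well_order (A : Type) (lt : A -> A -> Prop) : Prop :=
  (forall x, ~ lt x x) /\
  (forall x y z, lt x y -> lt y z -> lt x z) /\
  (forall x y, lt x y \/ x = y \/ lt y x) /\
  well_founded lt.

Lemma wf_min (A : Type) (lt : A -> A -> Prop) (Hwf : well_founded lt) (Q : A -> Prop) :
  (exists x, Q x) -> exists m, Q m /\ forall z, lt z m -> ~ Q z.
Proof.
  intros [x Hx]. revert Hx. induction (Hwf x) as [x _ IH]. intros Hx.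
  destruct (classic (exists z, lt z x /\ Q z)) as [[z [Hz Qz]]|N].
  - exact (IH z Hz Qz).
  - exists x. split; [assumption|]. intros z Hz Qz. apply N. eauto.
Qed.

Lemma min_wf (A : Type) (lt : A -> A -> Prop) :
  (forall Q : A -> Prop, (exists x, Q x) -> exists m, Q m /\ forall z, lt z m -> ~ Q z) ->
  well_founded lt.
Proof.
  intros H x. apply NNPP. intros N.
  destruct (H (fun x => ~ Acc lt x)) as [m [Hm1 Hm2]]; [eauto|].
  apply Hm1. constructor. intros z Hz. apply NNPP. exact (Hm2 z Hz).
Qed.

Lemma lex_wf (A B C : Type) (ltB : B -> B -> Prop) (ltC : C -> C -> Prop)
    (f : A -> B) (g : A -> C) : well_founded ltB -> well_founded ltC ->
  well_founded (fun x y => ltB (f x) (f y) \/ (f x = f y /\ ltC (g x) (g y))).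
Proof.
  intros HB HC.
  apply wf_incl with (R2 := fun x y => slexprod B C ltB ltC (f x, g x) (f y, g y)).
  - intros x y [H|[E H]]; [apply left_slex; assumption|].
    rewrite E. apply right_slex. assumption.
  - apply wf_inverse_image with (f := fun x => (f x, g x)). apply wf_slexprod; assumption.
Qed.

(** The principle supplies a relation in which each nonempty set has a unique least element.
    Reflexivity, totality, antisymmetry and transitivity follow by testing sets of at most three
    elements; its strict part is the required order. *)
Theorem zermelo (A : Type) : exists lt : A -> A -> Prop, well_order lt.
Proof.
  destruct (wochoice.well_ordering_principle
    (eqtype.Equality.Pack (eqtype.Equality.Class (boolp.gen_eqMixin A)))) as [R HR].
  assert (Hmin : forall Q : A -> Prop, (exists x, Q x) ->
      exists m, Q m /\ (forall z, Q z -> R m z = true) /\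
        forall m', Q m' -> (forall z, Q z -> R m' z = true) -> m' = m).
  { intros Q [x Hx].
    destruct (HR (fun z => boolp.asbool (Q z))) as [m [[Hm1 Hm2] Hm3]].
    - exists x. apply boolp.asboolT. exact Hx.
    - exists m. split; [exact (boolp.asboolW Hm1)|]. split.
      + intros z Hz. apply Hm2. apply boolp.asboolT. exact Hz.
      + intros m' Qm' Hm'. symmetry. apply Hm3. split; [apply boolp.asboolT; exact Qm'|].
        intros z Hz. apply Hm'. exact (boolp.asboolW Hz). }
  assert (Hrefl : forall x, R x x = true).
  { intros x. destruct (Hmin (eq x)) as [m [<- [H _]]]; eauto. }
  assert (Htot : forall x y, R x y = true \/ R y x = true).
  { intros x y. destruct (Hmin (fun z => z = x \/ z = y)) as [m [[-> | ->] [H _]]]; eauto. }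
  assert (Hanti : forall x y, R x y = true -> R y x = true -> x = y).
  { intros x y Hxy Hyx. destruct (Hmin (fun z => z = x \/ z = y)) as [m [_ [_ H]]]; [eauto|].
    transitivity m; [|symmetry]; apply H; auto; intros z [-> | ->]; auto. }
  assert (Htr : forall x y z, R x y = true -> R y z = true -> R x z = true).
  { intros x y z Hxy Hyz.
    destruct (Hmin (fun t => t = x \/ t = y \/ t = z)) as [m [Hm [H _]]]; [eauto|].
    destruct Hm as [-> | [-> | ->]].
    - auto.
    - rewrite (Hanti x y); auto.
    - rewrite <- (Hanti y z); auto. }
  exists (fun x y => x <> y /\ R x y = true). split; [|split; [|split]].
  - intros x [N _]. contradiction.
  - intros x y z [Nxy Hxy] [Nyz Hyz]. split; [|eauto].
    intros <-. auto.
  - intros x y. destruct (classic (x = y)); [auto|].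
    destruct (Htot x y); [left|right; right]; auto.
  - apply min_wf. intros Q HQ. destruct (Hmin Q HQ) as [m [Qm [H _]]].
    exists m. split; [assumption|]. intros z [Nz Hz] Qz. auto.
Qed.

(* The [if] hides the values that have not yet been constructed. *)
Lemma wf_choice (I B : Type) (lt : I -> I -> Prop) (Hwf : well_founded lt) (d : B)
    (Phi : I -> (I -> B) -> B -> Prop) :
  (forall u f, exists b, Phi u f b) ->
  exists K : I -> B, forall u,
    Phi u (fun w => if excluded_middle_informative (lt w u) then K w else d) (K u).
Proof.
  intros H.
  set (F := fun (u : I) (rec : forall w, lt w u -> B) =>
    proj1_sig (constructive_indefinite_description _
      (H u (fun w => match excluded_middle_informative (lt w u) with
                     | left h => rec w h | right _ => d end)))).
  exists (Fix Hwf (fun _ => B) F). intros u.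
  rewrite Fix_eq.
  - unfold F at 2.
    destruct (constructive_indefinite_description) as [b Hb]. simpl.
    match goal with |- Phi u ?f b => match type of Hb with Phi u ?f' b =>
      replace f with f'; [exact Hb|] end end.
    apply functional_extensionality. intros w.
    destruct (excluded_middle_informative (lt w u)); reflexivity.
  - intros x f f' E. replace f' with f; [reflexivity|].
    apply functional_extensionality_dep. intros w.
    apply functional_extensionality. intros h. apply E.
Qed.

(** * Finite and countable sets *)

(** The list may contain further elements, so that finiteness passes to subsets without
    filtering. *)
Definition fin (A : Type) (S : A -> Prop) : Prop := exists l, forall x, S x -> In x l.

Lemma fin_sub (A : Type) (S T : A -> Prop) : fin T -> (forall x, S x -> T x) -> fin S.
Proof. intros [l Hl] H. exists l. auto. Qed.

Lemma fin_or (A : Type) (S T : A -> Prop) : fin S -> fin T -> fin (fun x => S x \/ T x).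
Proof.
  intros [l Hl] [k Hk]. exists (l ++ k). intros x Hx. apply in_or_app. intuition.
Qed.

Lemma fin_inj_preimage (A B : Type) (f : A -> B) (S : B -> Prop) :
  (forall x y, f x = f y -> x = y) -> fin S -> fin (fun x => S (f x)).
Proof.
  intros Hf [l Hl].
  assert (H : forall l, fin (fun x => In (f x) l)).
  { clear l Hl. induction l as [|b l IH]; [exists nil; auto|].
    assert (fin (fun x => b = f x)) as Hb.
    { destruct (classic (exists x, b = f x)) as [[x ->]|N].
      - exists [x]. intros y E. left. auto.
      - exists nil. intros y E. apply N. eauto. }
    exact (fin_or Hb IH). }
  apply (fin_sub (H l)). auto.
Qed.

Lemma fin_union (A B : Type) (S : A -> Prop) (R : A -> B -> Prop) :
  fin S -> (forall x, S x -> fin (R x)) -> fin (fun y => exists x, S x /\ R x y).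
Proof.
  intros [l Hl] HR.
  assert (H : forall l, fin (fun y => exists x, In x l /\ S x /\ R x y)).
  { clear l Hl. induction l as [|a l IH].
    - exists nil. intros y [x [[] _]].
    - assert (fin (fun y => S a /\ R a y)) as Ha.
      { destruct (classic (S a)) as [Sa|N].
        - apply (fin_sub (HR a Sa)). tauto.
        - exists nil. intros y [H _]. contradiction. }
      apply (fin_sub (fin_or Ha IH)). intros y [x [[<-|Hx] Hy]]; [left; auto|right; eauto]. }
  apply (fin_sub (H l)). intros y [x [Hx Hy]]. eauto.
Qed.

Lemma not_fin_ex (A : Type) (S T : A -> Prop) : ~ fin S -> fin T -> exists x, S x /\ ~ T x.
Proof.
  intros HS HT. apply NNPP. intros N. apply HS. apply (fin_sub HT).
  intros x Hx. apply NNPP. eauto.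
Qed.

Definition countable (A : Type) (S : A -> Prop) : Prop :=
  exists code : A -> nat, forall x y, S x -> S y -> code x = code y -> x = y.

Lemma countable_sub (A : Type) (S T : A -> Prop) :
  countable T -> (forall x, S x -> T x) -> countable S.
Proof. intros [c Hc] H. exists c. auto. Qed.

(** An element [y] is coded by a pair: the code of one chosen index [x] with [R x y], and the code
    of [y] within [R x]. *)
Lemma countable_union (A B : Type) (S : A -> Prop) (R : A -> B -> Prop) :
  countable S -> (forall x, S x -> countable (R x)) ->
  countable (fun y => exists x, S x /\ R x y).
Proof.
  intros [c Hc] HR.
  assert (H1 : forall x, exists d : B -> nat, S x ->
    forall y z, R x y -> R x z -> d y = d z -> y = z).
  { intros x. destruct (classic (S x)) as [Sx|N].
    - destruct (HR x Sx) as [d Hd]. exists d. auto.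
    - exists (fun _ => 0). intros; contradiction. }
  destruct (choice _ H1) as [d Hd].
  assert (H2 : forall y, exists n : nat, (exists x, S x /\ R x y) ->
     exists x, S x /\ R x y /\ n = to_nat (c x, d x y)).
  { intros y. destruct (classic (exists x, S x /\ R x y)) as [[x Hx]|N].
    - exists (to_nat (c x, d x y)). intros _. exists x. tauto.
    - exists 0. intros; contradiction. }
  destruct (choice _ H2) as [e He]. exists e. intros y z Hy Hz E.
  destruct (He y Hy) as [x [Sx [Rx Ex]]]. destruct (He z Hz) as [x' [Sx' [Rx' Ex']]].
  rewrite Ex, Ex' in E.
  apply (f_equal of_nat) in E. rewrite !cancel_of_to in E. injection E as E1 E2.
  assert (x = x') by auto. subst x'. eauto.
Qed.

Lemma countable_union_nat (B : Type) (R : nat -> B -> Prop) :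
  (forall n, countable (R n)) -> countable (fun y => exists n, R n y).
Proof.
  intros H. apply countable_sub with (T := fun y => exists n, True /\ R n y).
  - apply countable_union; [|auto]. exists (fun n => n). auto.
  - intros y [n Hn]. eauto.
Qed.

Lemma countable_or (A : Type) (S T : A -> Prop) :
  countable S -> countable T -> countable (fun x => S x \/ T x).
Proof.
  intros HS HT.
  apply countable_sub with (T := fun x => exists n, match n with 0 => S x | _ => T x end).
  - apply countable_union_nat. intros [|n]; assumption.
  - intros x [H|H]; [exists 0|exists 1]; assumption.
Qed.

Lemma countable_single (A : Type) (a : A) : countable (eq a).
Proof. exists (fun _ => 0). intros; congruence. Qed.

Lemma countable_fin (A : Type) (S : A -> Prop) : fin S -> countable S.
Proof.
  intros [l Hl]. apply countable_sub with (T := fun x => In x l); [|auto]. clear.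
  induction l as [|a l IH].
  - exists (fun _ => 0). intros x y [].
  - exact (countable_or (countable_single a) IH).
Qed.

Lemma countable_image (A B : Type) (S : A -> Prop) (f : A -> B) :
  countable S -> countable (fun y => exists x, S x /\ f x = y).
Proof. intros H. apply countable_union; [assumption|]. intros x _. apply countable_single. Qed.

Lemma countable_closure (A : Type) (c : A -> A -> Prop) (a : A) :
  (forall x, countable (c x)) -> countable (clos_refl_trans A c a).
Proof.
  intros Hc.
  set (R := fix R (n : nat) : A -> Prop :=
    match n with 0 => eq a | S n => fun y => exists x, R n x /\ c x y end).
  apply countable_sub with (T := fun y => exists n, R n y).
  - apply countable_union_nat. intros n. induction n as [|n IH]; simpl.
    + apply countable_single.
    + apply countable_union; auto.
  - intros y Hy. apply clos_rt_rtn1 in Hy. induction Hy as [|y z Hyz _ [n IH]].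
    + exists 0. reflexivity.
    + exists (S n). simpl. eauto.
Qed.

Lemma fin_bounded_code (A : Type) (S : A -> Prop) (code : A -> nat) (n : nat) :
  (forall x y, S x -> S y -> code x = code y -> x = y) ->
  fin (fun x => S x /\ code x < n).
Proof.
  intros H. induction n as [|n IH].
  - exists nil. intros x [_ Hx]. lia.
  - assert (Hn : fin (fun x => S x /\ code x = n)).
    { destruct (classic (exists x, S x /\ code x = n)) as [[x [Sx Ex]]|N].
      - exists [x]. intros y [Sy Ey]. left. apply H; auto. congruence.
      - exists nil. intros y Hy. apply N. eauto. }
    apply (fin_sub (fin_or IH Hn)). intros x [Sx Hx].
    destruct (Nat.eq_dec (code x) n); [right|left; split]; auto. lia.
Qed.

Lemma infinite_seq (A : Type) (S : A -> Prop) : ~ fin S ->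
  exists f : nat -> A, (forall n, S (f n)) /\ (forall m n, m < n -> f n <> f m).
Proof.
  intros HS.
  destruct (@not_fin_ex _ S (fun _ => False) HS) as [d _]; [exists nil; auto|].
  destruct (@wf_choice nat A lt lt_wf d
    (fun n f b => S b /\ forall m, m < n -> b <> f m)) as [f Hf].
  - intros n f. destruct (@not_fin_ex _ S (fun x => In x (map f (seq 0 n))) HS) as [b [Hb Hn]].
    { eexists. eauto. }
    exists b. split; [assumption|]. intros m Hm ->. apply Hn.
    apply in_map. apply in_seq. lia.
  - exists f. split.
    + intros n. apply Hf.
    + intros m n Hmn. destruct (Hf n) as [_ H]. specialize (H m Hmn).
      destruct (excluded_middle_informative (m < n)) as [|N]; [assumption|contradiction].
Qed.

Lemma seq_not_fin (A : Type) (S : A -> Prop) (f : nat -> A) :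
  (forall n, S (f n)) -> (forall m n, m < n -> f n <> f m) -> ~ fin S.
Proof.
  intros Sf Hf [l Hl].
  assert (H : NoDup (map f (seq 0 (1 + length l)))).
  { generalize (1 + length l). intros k. generalize 0. induction k as [|k IH]; intros m; simpl.
    - constructor.
    - constructor; [|apply IH]. intros Hin. apply in_map_iff in Hin.
      destruct Hin as [j [E Hj]]. apply in_seq in Hj. apply (Hf m j); [lia|assumption]. }
  apply NoDup_incl_length with (l' := l) in H.
  - rewrite length_map, length_seq in H. lia.
  - intros x Hx. apply in_map_iff in Hx. destruct Hx as [j [<- _]]. auto.
Qed.

(** Take a sequence of distinct elements [y] and one witness [d] for each; these witnesses form [Q].
    This lets a countable branch set inherit infinitely many neighbours from a possibly uncountable
    region. *)
Lemma infinite_capture (A B : Type) (D : B -> Prop) (R : A -> B -> Prop) :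
  ~ fin (fun y => exists d, D d /\ R y d) ->
  exists Q : B -> Prop, countable Q /\ (forall d, Q d -> D d) /\
    ~ fin (fun y => exists d, Q d /\ R y d).
Proof.
  intros H. destruct (infinite_seq H) as [f [Hf Hinj]].
  destruct (choice _ Hf) as [d Hd].
  exists (fun b => exists n, d n = b). split; [|split].
  - apply countable_union_nat. intros n. apply countable_single.
  - intros b [n <-]. apply Hd.
  - apply seq_not_fin with (f := f); [|assumption].
    intros n. exists (d n). split; [eauto|apply Hd].
Qed.

Lemma no_max_not_fin (A : Type) (lt : A -> A -> Prop) (S : A -> Prop) :
  well_order lt -> (exists x, S x) -> (forall x, S x -> exists y, S y /\ lt x y) -> ~ fin S.
Proof.
  intros [Hirr [Htr [Htot _]]] [x0 Hx0] Hup [l Hl].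
  assert (H : forall l, exists y, S y /\ forall x, In x l -> S x -> lt x y).
  { clear l Hl. induction l as [|a l [y [Sy Hy]]].
    - exists x0. split; [assumption|]. intros x [].
    - destruct (classic (S a /\ ~ lt a y)) as [[Sa Hay]|N].
      + destruct (Hup a Sa) as [z [Sz Haz]]. exists z. split; [assumption|].
        intros x [<-|Hx] Sx; [assumption|].
        destruct (Htot a y) as [?|[<-|Hya]]; [contradiction|eauto|eauto].
      + exists y. split; [assumption|]. intros x [<-|Hx] Sx; [|auto].
        apply NNPP. tauto. }
  destruct (H l) as [y [Sy Hy]]. exact (Hirr y (Hy y (Hl y Sy) Sy)).
Qed.

(** * Paths as lists *)

Section Paths.
Variables (A : Type) (e : A -> A -> Prop).

Lemma chain_app (l1 l2 : list A) (x : A) :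
  chain e (l1 ++ x :: l2) <-> chain e (l1 ++ [x]) /\ chain e (x :: l2).
Proof.
  induction l1 as [|a l1 IH].
  - simpl. tauto.
  - destruct l1 as [|b l1]; simpl in IH |- *; tauto.
Qed.

Lemma chain_mono (f : A -> A -> Prop) (l : list A) :
  (forall x y, e x y -> f x y) -> chain e l -> chain f l.
Proof.
  intros H. induction l as [|a [|b l] IH]; simpl; auto.
  intros [H1 H2]. split; [auto|exact (IH H2)].
Qed.

Lemma chain_rev (l : list A) : (forall x y, e x y -> e y x) -> chain e l -> chain e (rev l).
Proof.
  intros Hsym. induction l as [|a [|b l] IH]; auto.
  intros [H1 H2]. simpl in IH |- *. rewrite <- app_assoc. simpl.
  apply chain_app. split; [auto|]. simpl. auto.
Qed.

Lemma list_last (a : A) (l : list A) : exists m, a :: l = m ++ [last (a :: l) a].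
Proof. exists (removelast (a :: l)). apply app_removelast_last. discriminate. Qed.

Lemma last_default (l : list A) (a d d' : A) : last (a :: l) d = last (a :: l) d'.
Proof. revert a. induction l as [|b l IH]; intros a; [reflexivity|]. exact (IH b). Qed.

Lemma last_app (m l : list A) (a d : A) : last (m ++ a :: l) d = last (a :: l) a.
Proof.
  induction m as [|x m IH]; [apply last_default|].
  rewrite <- IH. simpl. destruct (m ++ a :: l) eqn:E; [destruct m; discriminate|reflexivity].
Qed.

Lemma chain_all (P : A -> Prop) (l : list A) : forall a,
  chain (fun x y => e x y /\ P x /\ P y) (a :: l) -> P a -> forall v, In v (a :: l) -> P v.
Proof.
  induction l as [|b l IH]; intros a Hc Ha v [<-|Hv]; auto.
  - destruct Hv.
  - destruct Hc as [[_ [_ Hb]] Hc]. exact (IH b Hc Hb v Hv).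
Qed.

Lemma path_cons (a b c : A) (l : list A) : is_path e a c (b :: l) ->
  e a b /\ is_path e b c l /\ ~ In a (b :: l).
Proof.
  intros [H1 [[H2 H2'] H3]]. inversion H1. split; [assumption|]. split; [|assumption].
  split; [assumption|]. split; [assumption|]. rewrite <- H3. symmetry. apply (last_app [a]).
Qed.

Lemma path_suffix (a b c : A) (m l l' : list A) : is_path e a c l ->
  a :: l = m ++ b :: l' -> is_path e b c l'.
Proof.
  intros [H1 [H2 H3]] E. rewrite E in *. split; [|split].
  - apply NoDup_app_remove_l with (l := m). assumption.
  - apply chain_app in H2. apply H2.
  - rewrite <- H3. symmetry. apply last_app.
Qed.

Lemma path_rev (a b : A) (l : list A) : (forall x y, e x y -> e y x) ->
  is_path e a b l -> exists l', is_path e b a l' /\ b :: l' = rev (a :: l).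
Proof.
  intros Hsym [H1 [H2 H3]]. destruct (list_last a l) as [m Hm]. rewrite H3 in Hm.
  exists (rev m).
  assert (E : b :: rev m = rev (a :: l)) by (rewrite Hm, rev_app_distr; reflexivity).
  split; [|assumption]. split; [|split].
  - rewrite E. apply NoDup_rev. assumption.
  - rewrite E. apply chain_rev; assumption.
  - rewrite E. simpl. apply last_last.
Qed.

Lemma reach_path (a b : A) : clos_refl_trans A e a b -> exists l, is_path e a b l.
Proof.
  intros H. apply clos_rt_rt1n in H. induction H as [a|a c b Hac _ [l [H1 [H2 H3]]]].
  - exists nil. split; [|split]; simpl; auto. constructor; [auto|constructor].
  - destruct (classic (In a (c :: l))) as [Hin|Hin].
    (* The new start vertex recurs later: keep only the part of the path from that occurrence on. *)
    + apply in_split in Hin. destruct Hin as [l1 [l2 E]]. exists l2.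
      apply path_suffix with (2 := E). split; [|split]; assumption.
    + exists (c :: l). split; [|split].
      * constructor; assumption.
      * split; assumption.
      * change (last (c :: l) a = b). rewrite (last_default l c a c). assumption.
Qed.

Lemma chain_connected (x : A) (l : list A) : (forall x y, e x y -> e y x) ->
  chain e (x :: l) -> connected_in e (fun v => In v (x :: l)).
Proof.
  intros Hsym Hc.
  set (r := fun (l : list A) a b => e a b /\ In a l /\ In b l).
  assert (Hm : forall l l' a b, (forall v, In v l -> In v l') ->
      clos_refl_trans A (r l) a b -> clos_refl_trans A (r l') a b).
  { intros k k' a b Hk. induction 1 as [a b [H1 [H2 H3]]|a|a b c _ IH1 _ IH2].
    - apply rt_step. split; auto.
    - apply rt_refl.
    - eapply rt_trans; eassumption. }
  assert (Hs : forall l a b, clos_refl_trans A (r l) a b -> clos_refl_trans A (r l) b a).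
  { intros k a b. induction 1 as [a b [H1 [H2 H3]]|a|a b c _ IH1 _ IH2].
    - apply rt_step. split; auto.
    - apply rt_refl.
    - eapply rt_trans; eassumption. }
  assert (H : forall v, In v (x :: l) -> clos_refl_trans A (r (x :: l)) x v).
  { revert x Hc. induction l as [|y l IH]; intros x Hc v Hv.
    - destruct Hv as [<-|[]]. apply rt_refl.
    - destruct Hv as [<-|Hv]; [apply rt_refl|]. destruct Hc as [Hxy Hc].
      eapply rt_trans; [apply rt_step; split; [exact Hxy|simpl; auto]|].
      apply Hm with (l := y :: l); [simpl; auto|]. exact (IH y Hc v Hv). }
  split; [exists x; simpl; auto|].
  intros a b Ha Hb. eapply rt_trans; [apply Hs|]; apply H; assumption.
Qed.

End Paths.

(** * Connected sets *)

Section Connected.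
Variables (V : Type) (adj : V -> V -> Prop).
Hypothesis adj_sym : forall x y, adj x y -> adj y x.

(** For [x] in [X], the set [reach X x] is the component of [x] in the subgraph induced on [X]. For
    [x] outside [X] it is the singleton of [x]. *)
Definition reach (X : V -> Prop) : V -> V -> Prop :=
  clos_refl_trans V (fun a b => adj a b /\ X a /\ X b).

Definition touch (A B : V -> Prop) : Prop := exists a b, A a /\ B b /\ adj a b.

Lemma touch_sym (A B : V -> Prop) : touch A B -> touch B A.
Proof. intros [a [b [Ha [Hb H]]]]. exists b, a. auto. Qed.

Lemma reach_sym (X : V -> Prop) x y : reach X x y -> reach X y x.
Proof.
  induction 1 as [x y [H [Hx Hy]]|x|x y z _ IH1 _ IH2].
  - apply rt_step. auto.
  - apply rt_refl.
  - eapply rt_trans; eassumption.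
Qed.

Lemma reach_mono (X Y : V -> Prop) x y :
  (forall v, X v -> Y v) -> reach X x y -> reach Y x y.
Proof.
  intros HXY. induction 1 as [x y [H [Hx Hy]]|x|x y z _ IH1 _ IH2].
  - apply rt_step. auto.
  - apply rt_refl.
  - eapply rt_trans; eassumption.
Qed.

Lemma reach_in (X : V -> Prop) x y : reach X x y -> X x -> X y.
Proof. induction 1 as [x y [H [Hx Hy]]|x|x y z _ IH1 _ IH2]; auto. Qed.

Lemma reach_step (X : V -> Prop) x y z :
  reach X x y -> X x -> adj y z -> X z -> reach X x z.
Proof.
  intros H Hx Hyz Hz. eapply rt_trans; [exact H|]. apply rt_step.
  pose proof (reach_in H Hx). auto.
Qed.

Lemma connected_comp (X : V -> Prop) x : X x -> connected_in adj (reach X x).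
Proof.
  intros Hx.
  assert (H : forall y, reach X x y -> reach (reach X x) x y).
  { intros y Hy. apply clos_rt_rtn1 in Hy. induction Hy as [|y z [H [Hy Hz]] Hxy IH].
    - apply rt_refl.
    - apply clos_rtn1_rt in Hxy. eapply rt_trans; [exact IH|]. apply rt_step.
      split; [assumption|]. split; [assumption|]. eapply reach_step; eauto. }
  split; [exists x; apply rt_refl|].
  intros y z Hy Hz. eapply rt_trans; [apply reach_sym|]; apply H; assumption.
Qed.

Lemma connected_sub_comp (D X : V -> Prop) u x z : connected_in adj D ->
  (forall v, D v -> X v) -> D x -> reach X u x -> D z -> reach X u z.
Proof.
  intros [_ HD] HDX Dx Hux Dz. eapply rt_trans; [exact Hux|].
  apply reach_mono with (X := D); [assumption|]. exact (HD x z Dx Dz).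
Qed.

Lemma crossing (X P : V -> Prop) a b : reach X a b -> P a -> ~ P b ->
  exists u v, X u /\ X v /\ adj u v /\ P u /\ ~ P v.
Proof.
  intros H. apply clos_rt_rt1n in H. induction H as [|a c b [H [Ha Hc]] _ IH]; intros Pa Pb.
  - contradiction.
  - destruct (classic (P c)); [auto|]. exists a, c. auto.
Qed.

Lemma connected_single x : connected_in adj (eq x).
Proof. split; [eauto|]. intros a b <- <-. apply rt_refl. Qed.

Lemma connected_star (I : Type) (C : I -> V -> Prop) (J : I -> Prop) (u : V) :
  (exists i, J i) -> (forall i, J i -> connected_in adj (C i) /\ C i u) ->
  connected_in adj (fun v => exists i, J i /\ C i v).
Proof.
  intros [i0 Hi0] H.
  assert (Hr : forall y, (exists i, J i /\ C i y) -> reach (fun v => exists i, J i /\ C i v) u y).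
  { intros y [i [Hi Hy]]. destruct (H i Hi) as [[_ HC] Hu].
    apply reach_mono with (X := C i); [eauto|]. exact (HC u y Hu Hy). }
  split.
  - exists u, i0. split; [assumption|]. apply H. assumption.
  - intros x y Hx Hy. eapply rt_trans; [apply reach_sym|]; apply Hr; assumption.
Qed.

Lemma connected_or (A B : V -> Prop) :
  connected_in adj A -> connected_in adj B -> touch A B ->
  connected_in adj (fun v => A v \/ B v).
Proof.
  intros [_ HA] [_ HB] [a [b [Aa [Bb Hab]]]].
  assert (Hr : forall y, A y \/ B y -> reach (fun v => A v \/ B v) a y).
  { intros y [Ay|By].
    - apply reach_mono with (X := A); [auto|]. exact (HA a y Aa Ay).
    - eapply rt_trans; [apply rt_step; repeat split; [exact Hab|auto|auto]|].
      apply reach_mono with (X := B); [auto|]. exact (HB b y Bb By). }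
  split; [eauto|].
  intros x y Hx Hy. eapply rt_trans; [apply reach_sym|]; apply Hr; assumption.
Qed.

(** For each [q] in [Q], collect the vertices of a walk in [D] from [u] to [q]. The union of these
    sets is connected because all of them contain [u]. *)
Lemma countable_capture (D Q : V -> Prop) (u : V) :
  connected_in adj D -> D u -> countable Q -> (forall v, Q v -> D v) ->
  exists K, countable K /\ connected_in adj K /\ K u /\
    (forall v, Q v -> K v) /\ (forall v, K v -> D v).
Proof.
  intros [_ HD] Du HQ HQD.
  assert (H : forall q, exists F, D q -> countable F /\ connected_in adj F /\ F u /\ F q /\
      (forall v, F v -> D v)).
  { intros q. destruct (classic (D q)) as [Dq|N]; [|exists (fun _ => True); tauto].
    specialize (HD u q Du Dq). apply clos_rt_rtn1 in HD. clear Dq.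
    induction HD as [|y z [Hyz [Dy Dz]] _ [F HF]].
    - exists (eq u). intros _. split; [apply countable_single|].
      split; [apply connected_single|]. repeat split; auto. intros v <-. assumption.
    - destruct (HF Dy) as [F1 [F2 [F3 [F4 F5]]]].
      exists (fun v => F v \/ z = v). intros _.
      split; [apply countable_or; [assumption|apply countable_single]|].
      split; [apply connected_or; [assumption|apply connected_single|exists y, z; auto]|].
      repeat split; auto. intros v [Hv| <-]; auto. }
  destruct (choice _ H) as [F HF].
  (* Admitting [u] itself as a target keeps [u] in the union when [Q] is empty. *)
  exists (fun v => exists q, (Q q \/ u = q) /\ F q v).
  assert (HQ' : forall q, Q q \/ u = q -> D q) by (intros q [Hq| <-]; auto).
  split; [|split; [|split; [|split]]].
  - apply countable_union; [apply countable_or; [assumption|apply countable_single]|].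
    intros q Hq. apply HF. auto.
  - apply connected_star with (u := u); [eauto|]. intros q Hq.
    destruct (HF q (HQ' q Hq)) as [_ [H1 [H2 _]]]. auto.
  - exists u. split; [auto|]. apply HF. assumption.
  - intros q Hq. exists q. split; [auto|]. apply HF. auto.
  - intros v [q [Hq Hv]]. destruct (HF q (HQ' q Hq)) as [_ [_ [_ [_ H5]]]]. auto.
Qed.

(** * Normal trees as parent relations *)

Section ParentTrees.
Hypothesis Hconn : graph_connected adj.
Variable r : V.

Definition verts (par : V -> V -> Prop) (v : V) : Prop := v = r \/ exists q, par q v.

Definition comparable (par : V -> V -> Prop) (a b : V) : Prop :=
  clos_refl_trans V par a b \/ clos_refl_trans V par b a.

(** Here [par q v] says that [q] is the parent of [v]; such relations grow easily by leaves and by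
    unions of chains. The last two clauses express normality for [T]-paths that are single edges and
    for those with inner vertices, where a connected set off the tree replaces the interior of the
    path. *)
Definition parent_tree (par : V -> V -> Prop) : Prop :=
  (forall q v, par q v -> adj q v /\ v <> r /\ clos_refl_trans V par r v) /\
  (forall q q' v, par q v -> par q' v -> q = q') /\
  (forall a b, verts par a -> verts par b -> adj a b -> comparable par a b) /\
  (forall C a b, connected_in adj C -> (forall v, C v -> ~ verts par v) ->
     verts par a -> verts par b -> touch (eq a) C -> touch (eq b) C -> comparable par a b).

Lemma anc_mono (par par' : V -> V -> Prop) x y : (forall q v, par q v -> par' q v) ->
  clos_refl_trans V par x y -> clos_refl_trans V par' x y.
Proof.
  intros H. induction 1 as [x y Hxy|x|x y z _ IH1 _ IH2].
  - apply rt_step. auto.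
  - apply rt_refl.
  - eapply rt_trans; eassumption.
Qed.

Lemma comparable_mono (par par' : V -> V -> Prop) x y : (forall q v, par q v -> par' q v) ->
  comparable par x y -> comparable par' x y.
Proof. intros H [Hc|Hc]; [left|right]; exact (anc_mono H Hc). Qed.

Lemma verts_mono (par par' : V -> V -> Prop) v : (forall q v, par q v -> par' q v) ->
  verts par v -> verts par' v.
Proof. intros H [Hv|[q Hq]]; [left; auto|right; eauto]. Qed.

Section OneTree.
Variable par : V -> V -> Prop.
Hypothesis Hpar : parent_tree par.
Let anc := clos_refl_trans V par.

Lemma anc_root v : verts par v -> anc r v.
Proof. intros [-> |[q Hq]]; [apply rt_refl|]. apply (proj1 Hpar q v Hq). Qed.

Lemma anc_verts x y : verts par x -> anc x y -> verts par y.
Proof.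
  intros Hx H. apply clos_rt_rtn1 in H. destruct H as [|z y Hzy _]; [assumption|right; eauto].
Qed.

Lemma anc_parent x q v : par q v -> anc x v -> x = v \/ anc x q.
Proof.
  intros Hqv H. apply clos_rt_rtn1 in H. destruct H as [|q' v Hq' H]; [auto|].
  right. rewrite (proj1 (proj2 Hpar) q q' v Hqv Hq'). apply clos_rtn1_rt. exact H.
Qed.

Lemma anc_of_root x : anc x r -> x = r.
Proof.
  intros H. apply clos_rt_rtn1 in H. inversion H as [|q v Hq]; [reflexivity|].
  exfalso. apply (proj1 Hpar q r); auto.
Qed.

Lemma parent_verts q v : par q v -> verts par q.
Proof.
  intros Hq. destruct (proj1 Hpar q v Hq) as [_ [N Hv]].
  destruct (anc_parent Hq Hv) as [E|H].
  - exfalso. auto.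
  - apply (anc_verts (or_introl eq_refl) H).
Qed.

Lemma anc_ind (Q : V -> Prop) : Q r ->
  (forall q v, verts par q -> par q v -> Q q -> Q v) -> forall v, verts par v -> Q v.
Proof.
  intros Hr Hs v Hv. pose proof (anc_root Hv) as H. apply clos_rt_rtn1 in H.
  induction H as [|q v Hqv H IH]; [assumption|].
  pose proof (parent_verts Hqv) as Hq. eauto.
Qed.

(** Induction from the root, which has no parent: since parents are unique, a cycle through the edge
    from [q] to [v] also uses the edge into [q]. *)
Lemma par_acyclic q v : par q v -> ~ anc v q.
Proof.
  intros Hqv. assert (Hv : verts par v) by (right; eauto). revert q Hqv.
  pattern v. revert v Hv. apply anc_ind.
  - intros q Hq. exfalso. apply (proj1 Hpar q r); auto.
  - intros q v _ Hqv IH q' Hq' H.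
    replace q' with q in H by exact (proj1 (proj2 Hpar) q q' v Hqv Hq'). clear q' Hq'.
    apply clos_rt_rtn1 in H. destruct H as [|q2 q Hq2 H].
    + apply (IH v Hqv). apply rt_refl.
    + apply (IH q2 Hq2). eapply rt_trans; [apply rt_step; exact Hqv|].
      apply clos_rtn1_rt. exact H.
Qed.

Lemma anc_fin v : verts par v -> fin (fun x => anc x v).
Proof.
  revert v. apply anc_ind.
  - exists [r]. intros x Hx. left. symmetry. apply anc_of_root. assumption.
  - intros q v _ Hqv [l Hl]. exists (v :: l). intros x Hx.
    destruct (anc_parent Hqv Hx) as [->|H]; [left|right]; auto.
Qed.

Lemma anc_crossing (P : V -> Prop) a b : anc a b -> P a -> ~ P b ->
  exists u v, par u v /\ P u /\ ~ P v /\ anc a v.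
Proof.
  intros H. apply clos_rt_rtn1 in H. induction H as [|v w Hvw H IH]; intros Pa Nb.
  - contradiction.
  - destruct (classic (P v)) as [Pv|Nv]; [|auto].
    exists v, w. repeat split; auto. eapply rt_trans; [apply clos_rtn1_rt; exact H|].
    apply rt_step. assumption.
Qed.

(** A connected set off the new tree is also off the old one, so old comparabilities persist. If it
    touches the new leaf [d], it lies in the old component of [d], all of whose tree neighbours are
    ancestors of [t] and hence of [d]. *)
Lemma leaf_tree t d : verts par t -> ~ verts par d -> adj t d ->
  (forall n, verts par n -> touch (eq n) (reach (fun v => ~ verts par v) d) -> anc n t) ->
  parent_tree (fun q v => par q v \/ (t = q /\ d = v)).
Proof.
  intros Ht Hd Htd Htop. set (par' := fun q v => par q v \/ (t = q /\ d = v)).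
  assert (Hsub : forall q v, par q v -> par' q v) by (intros; left; assumption).
  assert (Hverts : forall v, verts par' v -> verts par v \/ d = v).
  { intros v [H|[q [H|[_ H]]]]; [left; left|left; right|right]; eauto. }
  assert (Hanc : forall n, anc n t -> clos_refl_trans V par' n d).
  { intros n Hn. eapply rt_trans; [exact (anc_mono Hsub Hn)|]. apply rt_step. right. auto. }
  destruct Hpar as [P1 [P2 [P3 P4]]]. split; [|split; [|split]].
  - intros q v [H|[<- <-]].
    + destruct (P1 q v H) as [H1 [H2 H3]]. repeat split; auto. exact (anc_mono Hsub H3).
    + repeat split; auto.
      * intros ->. apply Hd. left. reflexivity.
      * apply Hanc. apply anc_root. assumption.
  - intros q q' v [H|[<- <-]] [H'|[<- E]]; eauto.
    + subst v. exfalso. apply Hd. right. eauto.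
    + exfalso. apply Hd. right. eauto.
  - assert (H : forall a, verts par a -> adj a d -> clos_refl_trans V par' a d).
    { intros a Ha Had. apply Hanc. apply Htop; [assumption|].
      exists a, d. repeat split; auto. apply rt_refl. }
    intros a b Ha Hb Hab.
    destruct (Hverts a Ha) as [Ha'|<-], (Hverts b Hb) as [Hb'|<-].
    + apply (comparable_mono Hsub). auto.
    + left. auto.
    + right. auto.
    + left. apply rt_refl.
  - intros C a b HC Hoff Ha Hb Hta Htb.
    assert (Hoff' : forall v, C v -> ~ verts par v).
    { intros v Cv Hv. exact (Hoff v Cv (verts_mono Hsub Hv)). }
    assert (H : touch (eq d) C -> forall a, verts par a -> touch (eq a) C ->
        clos_refl_trans V par' a d).
    { intros [d' [c [<- [Cc Hdc]]]] a' Ha' [a'' [c' [<- [Cc' Hac]]]].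
      apply Hanc. apply Htop; [assumption|]. exists a', c'. repeat split; auto.
      apply (@connected_sub_comp C _ d c c'); auto.
      apply rt_step. auto. }
    destruct (Hverts a Ha) as [Ha'|<-], (Hverts b Hb) as [Hb'|<-].
    + apply (comparable_mono Hsub). eauto.
    + left. auto.
    + right. auto.
    + left. apply rt_refl.
Qed.

End OneTree.

(** The vertices of the path are added one by one as leaves. After adding [d], the component of [x]
    can only have shrunk, so its neighbours are ancestors of [t] or equal to [d], and [d] takes over
    the role of [t]. *)
Lemma path_tree (x : V) (l : list V) : forall (par : V -> V -> Prop) (t d : V),
  parent_tree par -> verts par t -> adj t d -> is_path adj d x l ->
  (forall v, In v (d :: l) -> ~ verts par v) ->
  (forall n, verts par n -> touch (eq n) (reach (fun v => ~ verts par v) x) ->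
     clos_refl_trans V par n t) ->
  exists par', (forall q v, par q v -> par' q v) /\ parent_tree par' /\ clos_refl_trans V par' t x /\
    (forall v, verts par' v -> verts par v \/ clos_refl_trans V par' v x).
Proof.
  induction l as [|d' l IH]; intros par t d Hpar Ht Htd [H1 [H2 H3]] Hoff Htop;
    set (par1 := fun q v => par q v \/ (t = q /\ d = v));
    assert (Hsub : forall q v, par q v -> par1 q v) by (intros; left; assumption);
    assert (Hx : reach (fun v => ~ verts par v) x d).
  - simpl in H3. subst d. apply rt_refl.
  - simpl in H3. subst d. exists par1.
    split; [assumption|]. split; [|split].
    + apply leaf_tree; auto. apply Hoff. simpl. auto.
    + apply rt_step. right. auto.
    + intros v [->|[q [H|[_ <-]]]].
      * left. left. reflexivity.
      * left. right. eauto.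
      * right. apply rt_refl.
  - apply reach_sym. apply reach_mono with (X := fun v => In v (d :: d' :: l)); [assumption|].
    destruct (chain_connected adj_sym H2) as [_ H]. apply H; [simpl; auto|].
    destruct (list_last d (d' :: l)) as [m Hm]. rewrite H3 in Hm. rewrite Hm.
    apply in_or_app. simpl. auto.
  - assert (Hd : ~ verts par d) by (apply Hoff; simpl; auto).
    assert (Hv1 : forall v, verts par1 v -> verts par v \/ d = v).
    { intros v [->|[q [H|[_ H]]]]; [left; left|left; right|right]; eauto. }
    assert (Hp1 : parent_tree par1).
    { apply leaf_tree; auto. intros n Hn [n' [c [<- [Hc Hnc]]]]. apply Htop; [assumption|].
      exists n, c. repeat split; auto. eapply rt_trans; eassumption. }
    destruct (IH par1 d d') as [par' [Q1 [Q2 [Q3 Q4]]]]; auto.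
    + right. exists t. right. auto.
    + apply H2.
    + apply path_cons with (a := d). split; [|split]; assumption.
    + intros v Hv Hv'. destruct (Hv1 v Hv') as [H|<-].
      * apply (Hoff v); [right; exact Hv|assumption].
      * inversion H1. contradiction.
    + intros n Hn [n' [c [<- [Hc Hnc]]]].
      assert (Htd' : clos_refl_trans V par1 t d) by (apply rt_step; right; auto).
      destruct (Hv1 n Hn) as [Hn'|<-]; [|apply rt_refl].
      apply rt_trans with t; [|assumption]. apply (anc_mono Hsub).
      apply Htop; [assumption|]. exists n, c. repeat split; auto.
      apply reach_mono with (2 := Hc). intros v Hv Hv'. exact (Hv (verts_mono Hsub Hv')).
    + exists par'. split; [auto|]. split; [assumption|].
      split; [eapply rt_trans; [apply rt_step; apply Q1; right; auto|assumption]|].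
      intros v Hv. destruct (Q4 v Hv) as [H|H]; [|auto].
      destruct (Hv1 v H) as [H'|<-]; [auto|]. right. assumption.
Qed.

(** Each clause involves at most two edges or two vertices, and these lie in a common member of the
    chain. The exception is an empty family, whose union has the root as its only vertex. *)
Lemma union_tree (I : Type) (J : I -> Prop) (F : I -> V -> V -> Prop) :
  (forall i, J i -> parent_tree (F i)) ->
  (forall i j, J i -> J j -> (forall q v, F i q v -> F j q v) \/ (forall q v, F j q v -> F i q v)) ->
  parent_tree (fun q v => exists i, J i /\ F i q v).
Proof.
  intros HF Hch. set (par := fun q v => exists i, J i /\ F i q v).
  assert (Hsub : forall i, J i -> forall q v, F i q v -> par q v) by (intros i Hi q v H; exists i; auto).
  assert (Hv1 : forall v, verts par v -> v = r \/ exists i, J i /\ verts (F i) v).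
  { intros v [->|[q [i [Hi H]]]]; [auto|]. right. exists i. split; [assumption|]. right. eauto. }
  assert (Hv2 : forall a b, verts par a -> verts par b ->
    (a = r /\ b = r) \/ exists i, J i /\ verts (F i) a /\ verts (F i) b).
  { intros a b Ha Hb.
    destruct (Hv1 a Ha) as [->|[i [Hi Ha']]], (Hv1 b Hb) as [->|[j [Hj Hb']]].
    - auto.
    - right. exists j. repeat split; auto. left. reflexivity.
    - right. exists i. repeat split; auto. left. reflexivity.
    - right. destruct (Hch i j Hi Hj) as [H|H]; [exists j|exists i]; repeat split; auto;
        exact (verts_mono H ltac:(eassumption)). }
  split; [|split; [|split]].
  - intros q v [i [Hi H]]. destruct (proj1 (HF i Hi) q v H) as [H1 [H2 H3]].
    repeat split; auto. exact (anc_mono (Hsub i Hi) H3).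
  - intros q q' v [i [Hi H]] [j [Hj H']].
    destruct (Hch i j Hi Hj) as [Hs|Hs].
    + exact (proj1 (proj2 (HF j Hj)) q q' v (Hs _ _ H) H').
    + exact (proj1 (proj2 (HF i Hi)) q q' v H (Hs _ _ H')).
  - intros a b Ha Hb Hab. destruct (Hv2 a b Ha Hb) as [[-> ->]|[i [Hi [Ha' Hb']]]].
    + left. apply rt_refl.
    + apply (comparable_mono (Hsub i Hi)). apply HF; assumption.
  - intros C a b HC Hoff Ha Hb Hta Htb.
    destruct (Hv2 a b Ha Hb) as [[-> ->]|[i [Hi [Ha' Hb']]]].
    + left. apply rt_refl.
    + apply (comparable_mono (Hsub i Hi)).
      destruct (HF i Hi) as [_ [_ [_ H]]]. apply (H C a b); auto.
      intros v Cv Hv. exact (Hoff v Cv (verts_mono (Hsub i Hi) Hv)).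
Qed.

Lemma fin_top (N : V -> Prop) (R : V -> V -> Prop) :
  (exists x, N x) -> fin N -> (forall x, R x x) -> (forall x y z, R x y -> R y z -> R x z) ->
  (forall x y, N x -> N y -> R x y \/ R y x) -> exists t, N t /\ forall n, N n -> R n t.
Proof.
  intros [x0 Hx0] [l Hl] Hrefl Htr Htot.
  assert (H : forall l, exists t, N t /\ forall n, In n l -> N n -> R n t).
  { clear l Hl. induction l as [|a l [t [Nt Ht]]].
    - exists x0. split; [assumption|]. intros n [].
    - destruct (classic (N a /\ R t a)) as [[Na Ha]|N1].
      + exists a. split; [assumption|]. intros n [<-|Hn] Nn; eauto.
      + exists t. split; [assumption|]. intros n [<-|Hn] Nn; [|auto].
        destruct (Htot a t Nn Nt); [assumption|]. exfalso. auto. }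
  destruct (H l) as [t [Nt Ht]]. exists t. auto.
Qed.

Lemma extend_tree (par : V -> V -> Prop) (x : V) : parent_tree par ->
  fin (fun s => verts par s /\ touch (eq s) (reach (fun v => ~ verts par v) x)) ->
  exists par', (forall q v, par q v -> par' q v) /\ parent_tree par' /\ verts par' x /\
    (forall v, verts par' v -> verts par v \/ clos_refl_trans V par' v x).
Proof.
  intros Hpar Hfin. destruct (classic (verts par x)) as [Hx|Hx]; [exists par; auto|].
  set (D := reach (fun v => ~ verts par v) x).
  assert (HD : connected_in adj D) by (apply connected_comp; assumption).
  assert (Doff : forall v, D v -> ~ verts par v) by (intros v Hv; exact (reach_in Hv Hx)).
  destruct (@fin_top (fun s => verts par s /\ touch (eq s) D) (clos_refl_trans V par))
    as [t [[Ht [t' [d [<- [Dd Htd]]]]] Htop]].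
  (* [D] has a neighbour in the tree: a walk from [x] to the root must leave the component [D], and
     can do so only into a tree vertex. *)
  - destruct Hconn as [_ Hr]. specialize (Hr x r Logic.I Logic.I).
    destruct (@crossing (fun _ => True) D x r) as [u [v [_ [_ [Huv [Du Dv]]]]]].
    + exact Hr.
    + apply rt_refl.
    + intros H. apply (Doff r H). left. reflexivity.
    + exists v. split.
      * apply NNPP. intros N. apply Dv. apply reach_step with u; assumption.
      * exists v, u. auto.
  - assumption.
  - intros y. apply rt_refl.
  - intros y z w. apply rt_trans.
  - intros y z [Hy Hty] [Hz Htz]. destruct Hpar as [_ [_ [_ H]]]. exact (H D y z HD Doff Hy Hz Hty Htz).
  - destruct (reach_path (reach_sym Dd)) as [l [L1 [L2 L3]]].
    destruct (@path_tree x l par t d) as [par' [Q1 [Q2 [Q3 Q4]]]]; auto.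
    + split; [assumption|]. split; [|assumption].
      apply chain_mono with (2 := L2). tauto.
    + exact (chain_all L2 (Doff d Dd)).
    + exists par'. split; [assumption|]. split; [assumption|]. split; [|assumption].
      apply anc_verts with t; [|assumption]. exact (verts_mono Q1 Ht).
Qed.

(** Linearity is asked for on [X] only, so [R] may take arbitrary values elsewhere. The connected
    set [C] stands for the component of [x] in the complement of the initial segment before [x]. *)
Definition adhesion_order (X : V -> Prop) (R : V -> V -> Prop) : Prop :=
  well_founded R /\
  (forall x y z, R x y -> R y z -> R x z) /\
  (forall x y, X x -> X y -> R x y \/ x = y \/ R y x) /\
  forall x C, X x -> connected_in adj C -> C x -> (forall v, C v -> X v -> ~ R v x) ->
    fin (fun s => (X s /\ R s x) /\ exists d, C d /\ adj s d).

Lemma adhesion_order_tree (X : V -> Prop) (R : V -> V -> Prop) : adhesion_order X R ->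
  exists par, parent_tree par /\ forall x, X x -> verts par x.
Proof.
  intros [Rwf [Rtr [Rtot Rfin]]].
  set (ext := fun x (par par' : V -> V -> Prop) =>
    (forall q v, par q v -> par' q v) /\ parent_tree par' /\ verts par' x /\
    (forall v, verts par' v -> verts par v \/ clos_refl_trans V par' v x)).
  set (prev := fun (F : V -> V -> V -> Prop) x q v => exists z, (X z /\ R z x) /\ F z q v).
  (* The condition is vacuous where no extension exists, because [wf_choice] asks for a value in
     every case; [Hstep] later shows that an extension does exist. *)
  destruct (@wf_choice V (V -> V -> Prop) R Rwf (fun _ _ => False)
    (fun x F par' => (exists par'', ext x (prev F x) par'') -> ext x (prev F x) par')) as [F HF].
  { intros x F. destruct (classic (exists par'', ext x (prev F x) par'')) as [[p Hp]|N].
    - exists p. auto.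
    - exists (fun _ _ => False). contradiction. }
  assert (HF' : forall x, (exists par', ext x (prev F x) par') -> ext x (prev F x) (F x)).
  { intros x. specialize (HF x). cbv beta in HF.
    match type of HF with context [prev ?f x] => replace (prev f x) with (prev F x) in HF;
      [exact HF|] end.
    apply functional_extensionality. intros q. apply functional_extensionality. intros v.
    apply propositional_extensionality. unfold prev.
    split; intros [z [[Xz Hz] H]]; exists z; (split; [auto|]);
      destruct (excluded_middle_informative (R z x)); auto; contradiction. }
  clear HF. rename HF' into HF.
  assert (Rirr : forall x, ~ R x x).
  { intros x. induction (Rwf x) as [x _ IH]. intros H. exact (IH x H H). }
  (* Every vertex of the tree built so far lies below a vertex already processed, hence the tree
     meets the next component only in ancestors of its finitely many neighbours. *)
  assert (Hstep : forall x, X x -> (forall z, X z -> R z x -> ext z (prev F z) (F z)) ->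
      parent_tree (prev F x) /\ ext x (prev F x) (F x)).
  { intros x Xx IH.
    assert (Hmono : forall z w, X z -> X w -> R w x -> R z w -> forall q v, F z q v -> F w q v).
    { intros z w Xz Xw Hw Hzw q v H. apply (IH w Xw Hw). exists z. auto. }
    assert (Hpar : parent_tree (prev F x)).
    { apply union_tree.
      - intros z [Xz Hz]. apply (IH z Xz Hz).
      - intros z w [Xz Hz] [Xw Hw]. destruct (Rtot z w Xz Xw) as [H|[<-|H]]; [left|left; auto|right];
          apply Hmono; auto. }
    split; [assumption|]. apply HF. apply extend_tree; [assumption|].
    set (S := fun v => X v /\ R v x).
    assert (Sverts : forall v, S v -> verts (prev F x) v).
    { intros v Hv. destruct (IH v (proj1 Hv) (proj2 Hv)) as [_ [_ [H _]]].
      apply verts_mono with (2 := H). intros q w Hq. exists v. auto. }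
    assert (Habove : forall z, X z -> R z x -> forall t, verts (F z) t ->
        t = r \/ exists s, S s /\ clos_refl_trans V (prev F x) t s).
    { intros z. induction (Rwf z) as [z _ IHz]. intros Xz Hz t Ht.
      destruct (IH z Xz Hz) as [_ [_ [_ H]]]. destruct (H t Ht) as [[->|[q [w [[Xw Hw] Hq]]]]|H'].
      - auto.
      - apply (IHz w Hw Xw); [eauto|]. right. eauto.
      - right. exists z. split; [split; assumption|].
        apply anc_mono with (2 := H'). intros q v Hq. exists z. auto. }
    set (D := reach (fun v => ~ S v) x).
    assert (Sx : ~ S x) by (intros [_ H]; exact (Rirr x H)).
    assert (HM : fin (fun s => S s /\ exists d, D d /\ adj s d)).
    { apply Rfin; [assumption|apply connected_comp; assumption|apply rt_refl|].
      intros v Dv Xv Hv. apply (reach_in Dv Sx). split; assumption. }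
    apply fin_sub with (T := fun t => r = t \/
      exists s, (S s /\ exists d, D d /\ adj s d) /\ clos_refl_trans V (prev F x) t s).
    - apply fin_or; [exists [r]; intros t <-; simpl; auto|].
      apply fin_union; [assumption|]. intros s [Ss _]. apply anc_fin; auto.
    - intros t [Ht [t' [d [<- [Hd Htd]]]]].
      assert (Dd : D d).
      { apply reach_mono with (2 := Hd). intros v Hv Sv. auto. }
      destruct (classic (S t)) as [St|NS].
      { right. exists t. split; [eauto|apply rt_refl]. }
      assert (Dt : D t) by (apply reach_step with d; auto).
      assert (Ht' : t = r \/ exists s, S s /\ clos_refl_trans V (prev F x) t s).
      { destruct Ht as [->|[q [z [[Xz Hz] Hq]]]]; [auto|].
        apply (Habove z Xz Hz). right. eauto. }
      destruct Ht' as [->|[s [Ss Hts]]]; [auto|]. right.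
      (* The tree path from [t] in [D] to [s] outside [D] has an edge from [u] to [v] leaving [D].
         As [D] is a component of the complement of [S], its end [v] lies in [S]. *)
      destruct (@anc_crossing (prev F x) D t s Hts) as [u [v [Huv [Du [Dv Htv]]]]]; auto.
      + intros Ds. exact (reach_in Ds Sx Ss).
      + assert (Hadj : adj u v) by apply (proj1 Hpar u v Huv).
        exists v. split; [|assumption]. split; [|eauto].
        apply NNPP. intros Nv. apply Dv. apply reach_step with u; auto. }
  assert (Hall : forall x, X x -> ext x (prev F x) (F x)).
  { intros x. induction (Rwf x) as [x _ IH]. intros Xx. apply Hstep; auto. }
  exists (fun q v => exists z, X z /\ F z q v). split.
  - apply union_tree.
    + intros z Xz. apply (Hall z Xz).
    + intros z w Xz Xw. destruct (Rtot z w Xz Xw) as [H|[<-|H]]; [left|auto|right];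
        intros q v Hq.
      * apply (Hall w Xw). exists z. auto.
      * apply (Hall z Xz). exists w. auto.
  - intros x Xx. destruct (Hall x Xx) as [_ [_ [H _]]].
    apply verts_mono with (2 := H). intros q v Hq. eauto.
Qed.

(** * Parent trees are normal trees *)

Section Convert.
Variable par : V -> V -> Prop.
Hypothesis Hpar : parent_tree par.
Let anc := clos_refl_trans V par.
Let ET := fun x y => par x y \/ par y x.

(** A path that has once stepped from a parent to a child keeps doing so: by uniqueness of parents,
    a step back would repeat the preceding vertex. *)
Lemma path_up (l : list V) : forall a c, par a c -> NoDup (a :: c :: l) ->
  chain ET (a :: c :: l) -> anc c (last (c :: l) c).
Proof.
  induction l as [|e l IH]; intros a c Hac H1 H2; [apply rt_refl|].
  destruct H2 as [_ H2]. inversion H1 as [|? ? N1 H1']; subst.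
  destruct (proj1 H2) as [Hce|Hec].
  - eapply rt_trans; [apply rt_step; exact Hce|].
    rewrite (last_app [c] l e c : last (c :: e :: l) c = _). exact (IH c e Hce H1' H2).
  - exfalso. apply N1. rewrite (proj1 (proj2 Hpar) a e c Hac Hec). simpl. auto.
Qed.

(** If the path first steps to a child of [a], it ends in a descendant of [a], which its parent [b]
    is not. If it first steps to the parent, it is already at [b], and continuing would visit [b]
    twice. *)
Lemma no_cycle_down a b l : par b a -> is_path ET a b l -> length l <= 1.
Proof.
  intros Hba [H1 [H2 H3]]. destruct l as [|y [|z l]]; simpl; auto. exfalso.
  destruct (proj1 H2) as [Hay|Hya].
  - apply (par_acyclic Hpar Hay).
    apply rt_trans with b; [|apply rt_step; assumption]. rewrite <- H3.
    rewrite (last_app [a] (z :: l) y a : last (a :: y :: z :: l) a = _). exact (path_up Hay H1 H2).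
  - rewrite <- (proj1 (proj2 Hpar) b y a Hba Hya) in H1.
    inversion H1 as [|? ? _ H1']. inversion H1' as [|? ? N _]. apply N.
    destruct (list_last z l) as [m Hm]. rewrite Hm. apply in_or_app. right. left.
    rewrite <- H3. symmetry. apply (last_app [a; y]).
Qed.

Lemma anc_path y : verts par y ->
  exists l, is_path ET r y l /\ forall z, anc z y <-> In z (r :: l).
Proof.
  revert y. apply (anc_ind Hpar).
  - exists nil. split; [split; [|split]; simpl; auto; constructor; [auto|constructor]|].
    intros z. split.
    + intros H. left. symmetry. exact (anc_of_root Hpar H).
    + intros [<-|[]]. apply rt_refl.
  - intros q v _ Hqv [l [[H1 [H2 H3]] Hl]]. exists (l ++ [v]).
    split; [split; [|split]|].
    + change (NoDup ((r :: l) ++ [v])). apply NoDup_app.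
      * assumption.
      * constructor; [auto|constructor].
      * intros z Hz [<-|[]]. apply (par_acyclic Hpar Hqv). apply Hl. assumption.
    + change (chain ET ((r :: l) ++ [v])). destruct (list_last r l) as [m Hm].
      rewrite H3 in Hm. rewrite Hm in H2 |- *. rewrite <- app_assoc.
      apply chain_app. split; [assumption|]. simpl. split; [left; assumption|auto].
    + change (last ((r :: l) ++ [v]) r = v). apply last_last.
    + intros z. change (anc z v <-> In z ((r :: l) ++ [v])). rewrite in_app_iff, <- Hl.
      split.
      * intros H. destruct (anc_parent Hpar Hqv H) as [->|H']; simpl; auto.
      * intros [H|[<-|[]]]; [|apply rt_refl].
        eapply rt_trans; [exact H|]. apply rt_step. assumption.
Qed.

Lemma parent_tree_normal : normal_tree adj (verts par) ET r.
Proof.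
  assert (ET_sym : forall x y, ET x y -> ET y x) by (intros x y [H|H]; [right|left]; assumption).
  assert (Hc : forall v v', verts par v -> verts par v' -> comparable par v v' ->
      tree_le ET r v v' \/ tree_le ET r v' v).
  { intros v v' Hv Hv' [H|H]; [left|right].
    - destruct (anc_path Hv') as [l [Hl Hz]]. exists l. split; [assumption|]. apply Hz. assumption.
    - destruct (anc_path Hv) as [l [Hl Hz]]. exists l. split; [assumption|]. apply Hz. assumption. }
  split; [split; [|split; [|split; [|split]]]|].
  - assert (H : forall x y, par x y -> adj x y /\ verts par x /\ verts par y).
    { intros x y Hxy. split; [apply (proj1 Hpar x y Hxy)|].
      split; [exact (parent_verts Hpar Hxy)|right; eauto]. }
    intros x y [Hxy|Hyx]; [auto|]. destruct (H y x Hyx) as [H1 [H2 H3]]. auto.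
  - exact ET_sym.
  - left. reflexivity.
  - assert (H : forall v, verts par v ->
        clos_refl_trans V (fun a b => ET a b /\ verts par a /\ verts par b) r v /\
        clos_refl_trans V (fun a b => ET a b /\ verts par a /\ verts par b) v r).
    { apply (anc_ind Hpar); [split; apply rt_refl|].
      intros q v Hq Hqv [IH1 IH2]. assert (Hv : verts par v) by (right; eauto).
      split.
      - eapply rt_trans; [exact IH1|]. apply rt_step. repeat split; auto. left. assumption.
      - eapply rt_trans; [|exact IH2]. apply rt_step. repeat split; auto. right. assumption. }
    split; [exists r; left; reflexivity|].
    intros x y Hx Hy. apply rt_trans with r; [apply (H x Hx)|apply (H y Hy)].
  - intros a b l Hlen Hl [Hba|Hab].
    + pose proof (no_cycle_down Hba Hl). lia.
    + destruct (path_rev ET_sym Hl) as [l' [Hl' E]].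
      pose proof (no_cycle_down Hab Hl'). apply (f_equal (@length V)) in E.
      rewrite length_rev in E. simpl in E. lia.
  - intros a b inner [[H1 [H2 H3]] [Ha [Hb Hin]]].
    apply (chain_mono (f := adj)) in H2; [|tauto]. apply Hc; auto.
    destruct inner as [|v l].
    + destruct Hpar as [_ [_ [H _]]]. apply H; auto. apply H2.
    + change (a :: (v :: l) ++ [b]) with (a :: ((v :: l) ++ [b])) in H2.
      destruct (list_last v l) as [m Hm]. set (w := last (v :: l) v) in Hm.
      destruct H2 as [Hav H2]. change (chain adj ((v :: l) ++ [b])) in H2.
      rewrite Hm, <- app_assoc in H2. apply chain_app in H2. destruct H2 as [H2 [Hwb _]].
      rewrite <- Hm in H2.
      destruct Hpar as [_ [_ [_ H]]]. apply (H (fun x => In x (v :: l))); auto.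
      * exact (chain_connected adj_sym H2).
      * exists a, v. simpl. auto.
      * exists b, w. split; [reflexivity|]. split; [|auto].
        rewrite Hm. apply in_or_app. simpl. auto.
Qed.

End Convert.
End ParentTrees.

(** * Order-theoretic properties of normal trees *)

Section NormalTree.
Hypothesis adj_irr : forall x, ~ adj x x.
Variables (VT : V -> Prop) (ET : V -> V -> Prop) (r : V).
Hypothesis HT : normal_tree adj VT ET r.

Let ET_adj : forall x y, ET x y -> adj x y /\ VT x /\ VT y := proj1 (proj1 HT).
Let ET_sym : forall x y, ET x y -> ET y x := proj1 (proj2 (proj1 HT)).

(** Two distinct tree neighbours of [y] joined by a walk avoiding [y] would close a cycle. *)
Lemma tree_nbr_unique y x1 x2 : ET y x1 -> ET y x2 ->
  clos_refl_trans V (fun a b => ET a b /\ a <> y /\ b <> y) x1 x2 -> x1 = x2.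
Proof.
  intros H1 H2 Hr. apply NNPP. intros N.
  destruct (reach_path Hr) as [l [L1 [L2 L3]]].
  assert (Hy : x1 <> y) by (intros ->; apply (adj_irr (proj1 (ET_adj H1)))).
  pose proof (chain_all L2 Hy) as Hall.
  pose proof (proj2 (proj2 (proj2 (proj2 (proj1 HT))))) as Hac.
  apply (Hac y x2 (x1 :: l)); [|split; [|split]|apply ET_sym; assumption].
  - destruct l as [|z l]; simpl; [contradiction|lia].
  - constructor; [|assumption]. intros Hin. exact (Hall y Hin eq_refl).
  - split; [assumption|]. apply (chain_mono (f := ET)) in L2; [exact L2|tauto].
  - rewrite (last_app [y] l x1 y : last (y :: x1 :: l) y = _). assumption.
Qed.

Lemma root_path_unique l : forall l' y, is_path ET y r l -> is_path ET y r l' -> l = l'.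
Proof.
  assert (Hnil : forall y x l, is_path ET y r (x :: l) -> y <> r).
  { intros y x k Hl E. destruct (path_cons Hl) as [_ [[_ [_ H]] N]]. apply N.
    destruct (list_last x k) as [m Hm]. rewrite Hm, H. apply in_or_app. simpl. auto. }
  induction l as [|x1 l1 IH]; intros [|x2 l2] y H1 H2; [reflexivity|exfalso|exfalso|].
  - exact (Hnil y x2 l2 H2 (proj2 (proj2 H1))).
  - exact (Hnil y x1 l1 H1 (proj2 (proj2 H2))).
  - destruct (path_cons H1) as [E1 [P1 N1]]. destruct (path_cons H2) as [E2 [P2 N2]].
    assert (Hr : forall x l, is_path ET x r l -> ~ In y (x :: l) ->
        clos_refl_trans V (fun a b => ET a b /\ a <> y /\ b <> y) x r /\
        clos_refl_trans V (fun a b => ET a b /\ a <> y /\ b <> y) r x).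
    { intros x l [_ [Hc Hl]] N. destruct (list_last x l) as [m Hm]. rewrite Hl in Hm.
      assert (Hin : In r (x :: l)) by (rewrite Hm; apply in_or_app; simpl; auto).
      destruct (chain_connected ET_sym Hc) as [_ H].
      assert (Hm' : forall a b,
        clos_refl_trans V (fun a b => ET a b /\ In a (x :: l) /\ In b (x :: l)) a b ->
        clos_refl_trans V (fun a b => ET a b /\ a <> y /\ b <> y) a b).
      { intros a b. induction 1 as [a b [Q1 [Q2 Q3]]|a|a b c _ IH1 _ IH2].
        - apply rt_step. split; [assumption|].
          split; intros ->; contradiction.
        - apply rt_refl.
        - eapply rt_trans; eassumption. }
      split; apply Hm'; apply H; simpl; auto. }
    assert (x1 = x2) as <-.
    { apply tree_nbr_unique with y; auto.
      apply rt_trans with r; [apply (Hr x1 l1)|apply (Hr x2 l2)]; assumption. }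
    f_equal. exact (IH l2 x1 P1 P2).
Qed.

Lemma root_path_exists : exists down : V -> list V, forall y, VT y -> is_path ET y r (down y).
Proof.
  apply (choice (fun y l => VT y -> is_path ET y r l)). intros y. destruct (classic (VT y)) as [Hy|N]; [|exists nil; tauto].
  pose proof (proj1 (proj2 (proj2 (proj1 HT)))) as Hr.
  pose proof (proj2 (proj1 (proj2 (proj2 (proj2 (proj1 HT)))))) as Hc.
  destruct (reach_path (Hc y r Hy Hr)) as [l [H1 [H2 H3]]]. exists l. intros _.
  split; [assumption|]. split; [|assumption]. apply chain_mono with (2 := H2). tauto.
Qed.

Variable down : V -> list V.
Hypothesis Hdown : forall y, VT y -> is_path ET y r (down y).

(** The path is listed from [y] towards the root, which turns the tree order into the suffix
    relation on lists. *)
Definition tle (x y : V) : Prop := In x (y :: down y).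

Lemma suffix_down z m x l : VT z -> z :: down z = m ++ x :: l -> VT x /\ l = down x.
Proof.
  intros Hz E. assert (Hx : VT x).
  { apply (chain_all (e := ET)) with (a := z) (l := down z); [|assumption|].
    - apply chain_mono with (2 := proj1 (proj2 (Hdown Hz))).
      intros a b H. split; [assumption|]. apply (ET_adj H).
    - rewrite E. apply in_or_app. simpl. auto. }
  split; [assumption|]. apply root_path_unique with x; [|auto].
  exact (path_suffix (Hdown Hz) E).
Qed.

Lemma tle_suffix x z : VT z -> tle x z -> exists m, z :: down z = m ++ x :: down x.
Proof.
  intros Hz Hx. destruct (in_split _ _ Hx) as [m [l E]]. exists m.
  rewrite E. f_equal. f_equal. exact (proj2 (suffix_down Hz E)).
Qed.

Lemma tle_trans x y z : VT z -> tle x y -> tle y z -> tle x z.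
Proof.
  intros Hz Hxy Hyz. destruct (tle_suffix Hz Hyz) as [m E].
  unfold tle. rewrite E. apply in_or_app. right. exact Hxy.
Qed.

Lemma tle_chain x y z : VT z -> tle x z -> tle y z -> tle x y \/ tle y x.
Proof.
  intros Hz Hx Hy. destruct (tle_suffix Hz Hy) as [m E].
  unfold tle in Hx. rewrite E in Hx. apply in_app_or in Hx. destruct Hx as [Hx|Hx]; [|auto].
  right. destruct (in_split _ _ Hx) as [m1 [m2 Em]].
  rewrite Em, <- app_assoc in E. simpl in E.
  unfold tle. rewrite <- (proj2 (suffix_down Hz E)). right. apply in_or_app. simpl. auto.
Qed.

Lemma tle_height x y : VT y -> tle x y ->
  x = y \/ length (down x) < length (down y).
Proof.
  intros Hy Hxy. destruct (tle_suffix Hy Hxy) as [[|a m] E].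
  - left. injection E as E _. auto.
  - right. apply (f_equal (@length V)) in E. rewrite length_app in E. simpl in E. lia.
Qed.

Lemma tree_le_tle x y : VT y -> tree_le ET r x y -> tle x y.
Proof.
  intros Hy [l [Hl Hx]]. destruct (path_rev ET_sym Hl) as [l' [Hl' E]].
  rewrite (root_path_unique Hl' (Hdown Hy)) in E. unfold tle. rewrite E.
  apply in_rev in Hx. assumption.
Qed.

Lemma T_path_tle a b inner : T_path adj VT ET a b inner -> tle a b \/ tle b a.
Proof.
  intros H. destruct (proj2 HT a b inner H) as [Hab|Hba];
    destruct H as [_ [Ha [Hb _]]]; [left|right]; apply tree_le_tle; assumption.
Qed.

Lemma adj_tle a b : VT a -> VT b -> adj a b -> tle a b \/ tle b a.
Proof.
  intros Ha Hb Hab. destruct (classic (ET a b)) as [He|He].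
  - destruct (classic (tle b a)) as [Hba|N]; [auto|]. left.
    destruct (Hdown Ha) as [H1 [H2 H3]].
    unfold tle. replace (down b) with (a :: down a).
    + right. left. reflexivity.
    + apply root_path_unique with b; [|auto]. split; [|split].
      * constructor; assumption.
      * split; [apply ET_sym; assumption|assumption].
      * rewrite (last_app [b] (down a) a b : last (b :: a :: down a) b = _). assumption.
  - apply (@T_path_tle a b nil). split; [|simpl; tauto].
    assert (N : a <> b) by (intros <-; exact (adj_irr Hab)).
    split; [|split].
    + constructor; [intros [E|[]]; auto|constructor; [auto|constructor]].
    + simpl. auto.
    + reflexivity.
Qed.

Lemma off_tree_tle a b v w : VT a -> VT b -> a <> b -> adj a v -> ~ VT v ->
  reach (fun x => ~ VT x) v w -> adj w b -> tle a b \/ tle b a.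
Proof.
  intros Ha Hb Nab Hav Nv Hvw Hwb. destruct (reach_path Hvw) as [l [L1 [L2 L3]]].
  pose proof (chain_all L2 Nv) as Hoff.
  apply (@T_path_tle a b (v :: l)). split; [|auto].
  destruct (list_last v l) as [m Hm]. rewrite L3 in Hm.
  assert (NET : forall x y, ~ VT x \/ ~ VT y -> ~ ET x y).
  { intros x y H He. destruct (ET_adj He) as [_ [Hx Hy]]. tauto. }
  assert (Nw : ~ VT w) by (apply Hoff; rewrite Hm; apply in_or_app; simpl; auto).
  split; [|split].
  - constructor.
    + intros Hin. apply in_app_or in Hin. destruct Hin as [Hin|[E|[]]]; [|auto].
      exact (Hoff a Hin Ha).
    + apply NoDup_app; [assumption|constructor; [auto|constructor]|].
      intros z Hz [<-|[]]. exact (Hoff b Hz Hb).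
  - change (chain (fun x y => adj x y /\ ~ ET x y) ([a] ++ v :: (l ++ [b]))).
    apply chain_app. split; [simpl; auto|].
    change (chain (fun x y => adj x y /\ ~ ET x y) ((v :: l) ++ [b])).
    rewrite Hm, <- app_assoc. apply chain_app. split; [|simpl; auto].
    rewrite <- Hm. apply chain_mono with (2 := L2). intros x y [H1 [H2 H3]]. auto.
  - change (last ((a :: v :: l) ++ [b]) a = b). apply last_last.
Qed.

(** Take a tree vertex [t] of [C] of least height. Consecutive tree vertices on a walk in [C] are
    comparable, being equal or joined by an edge or a detour off the tree, so the walk never leaves
    the part of the tree above [t]. *)
Lemma connected_least (C : V -> Prop) : connected_in adj C -> (exists v, C v /\ VT v) ->
  exists t, C t /\ VT t /\ forall s, C s -> VT s -> tle t s.
Proof.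
  intros [_ HC] [v0 Hv0].
  destruct (@wf_min nat lt Wf_nat.lt_wf (fun n => exists t, (C t /\ VT t) /\ length (down t) = n))
    as [n [[t [[Ct Tt] <-]] Hmin]]; [eauto|].
  exists t. split; [assumption|]. split; [assumption|].
  (* If [b] is below [a], then [t] and [b] are comparable, and the least height of [t] rules out
     that [b] is strictly below it. *)
  assert (Hup : forall a b, VT a -> tle t a -> C b -> VT b -> tle a b \/ tle b a -> tle t b).
  { intros a b Ha Hta Cb Hb [H|H]; [exact (tle_trans Hb Hta H)|].
    destruct (tle_chain Ha Hta H) as [H'|H']; [assumption|].
    destruct (tle_height Tt H') as [->|Hlt]; [left; reflexivity|].
    exfalso. apply (Hmin _ Hlt). eauto. }
  (* For a vertex off the tree, remember where the walk last left the tree. *)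
  assert (Hinv : forall v, C v -> (VT v /\ tle t v) \/
    (~ VT v /\ exists a w, VT a /\ tle t a /\ adj a w /\ ~ VT w /\ reach (fun x => ~ VT x) w v)).
  { intros v Cv. specialize (HC t v Ct Cv). apply clos_rt_rtn1 in HC.
    induction HC as [|v v' [Hvv' [Cv0 Cv']] _ IH]; [left; split; [assumption|left; reflexivity]|].
    destruct (IH Cv0) as [[Hv Htv]|[Nv [a [w [Ha [Hta [Haw [Nw Hwv]]]]]]]];
      destruct (classic (VT v')) as [Hv'|Nv'].
    - left. split; [assumption|]. apply Hup with v; auto. apply adj_tle; assumption.
    - right. split; [assumption|]. exists v, v'. repeat split; auto. apply rt_refl.
    - left. split; [assumption|]. destruct (classic (a = v')) as [<-|Na]; [assumption|].
      apply Hup with a; auto. apply off_tree_tle with w v; assumption.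
    - right. split; [assumption|]. exists a, w. repeat split; auto.
      apply reach_step with v; assumption. }
  intros s Cs Hs. destruct (Hinv s Cs) as [[_ H]|[N _]]; [assumption|contradiction].
Qed.

Lemma normal_tree_colouring (W : Type) (adjH : W -> W -> Prop) (X : W -> V -> Prop) :
  is_minor adj adjH X -> (forall w, exists v, X w v /\ VT v) -> countable_colouring_number adjH.
Proof.
  intros [[Hsym Hirr] [Hdisj [HX Hedge]]] HXT.
  destruct (choice _ (fun w => connected_least (HX w) (HXT w))) as [t Ht].
  assert (Hinj : forall v w, t v = t w -> v = w).
  { intros v w E. apply NNPP. intros N. apply (Hdisj v w (t v) N); [apply Ht|].
    rewrite E. apply Ht. }
  (* Least vertices of different branch sets may have equal height; an arbitrary well-order breaks
     the ties. *)
  destruct (zermelo W) as [lt [Wirr [Wtr [Wtot Wwf]]]].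
  set (h := fun w => length (down (t w))).
  exists (fun v w => h v < h w \/ (h v = h w /\ lt v w)).
  split; [|split; [|split; [|split]]].
  - intros x [H|[_ H]]; [lia|exact (Wirr x H)].
  - intros x y z [H1|[E1 H1]] [H2|[E2 H2]]; [left; lia|left; lia|left; lia|right].
    split; [lia|eauto].
  - intros x y. destruct (Nat.lt_trichotomy (h x) (h y)) as [H|[H|H]]; [auto| |auto].
    destruct (Wtot x y) as [H'|[H'|H']]; auto.
  - exact (lex_wf h (fun w => w) Wf_nat.lt_wf Wwf).
  - intros w.
    assert (Hf : fin (fun u => tle (t u) (t w))).
    { apply (fin_inj_preimage (S := fun x => tle x (t w)) Hinj).
      exists (t w :: down (t w)). auto. }
    destruct Hf as [l Hl]. exists l. intros u Huw HR. apply Hl.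
    destruct (Hedge u w Huw) as [x [y [Hx [Hy Hxy]]]].
    (* The union of two adjacent branch sets is connected, and its least vertex lies in one of them.
       This makes [t u] and [t w] comparable, and the heights decide the direction. *)
    assert (HC : connected_in adj (fun v => X u v \/ X w v)).
    { apply connected_or; [apply HX|apply HX|exists x, y; auto]. }
    destruct (Ht u) as [Xu [Tu Lu]]. destruct (Ht w) as [Xw [Tw Lw]].
    destruct (connected_least HC) as [m [[Hm|Hm] [Tm Lm]]]; [eauto|..].
    + apply tle_trans with m; [assumption|apply Lu; assumption|apply Lm; auto].
    + assert (H : tle (t w) (t u)).
      { apply tle_trans with m; [assumption|apply Lw; assumption|apply Lm; auto]. }
      destruct (tle_height Tu H) as [E|Hlt]; [rewrite E; left; reflexivity|].
      fold (h w) in Hlt. fold (h u) in Hlt. lia.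
Qed.

End NormalTree.
(** * Rooted minors of countable colouring number *)

Variable U : V -> Prop.

Definition rooted_family (I : Type) (act : I -> Prop) (K : I -> V -> Prop) : Prop :=
  (forall i j x, act i -> act j -> i <> j -> K i x -> K j x -> False) /\
  (forall i, act i -> connected_in adj (K i)) /\
  (forall i, act i -> exists u, U u /\ K i u).

Hypothesis minors_colourable :
  forall (W : Type) (adjH : W -> W -> Prop) (X : W -> V -> Prop),
    is_minor adj adjH X -> U_rooted U X -> countable_colouring_number adjH.

(* Of a countable colouring number, only the resulting orientation with finite
   out-degrees is ever needed. *)
Lemma orientation (I : Type) (act : I -> Prop) (K : I -> V -> Prop) :
  rooted_family act K ->
  exists p : I -> I -> Prop, (forall i, fin (p i)) /\
    forall i j, act i -> act j -> i <> j -> touch (K i) (K j) -> p i j \/ p j i.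
Proof.
  intros [Hdisj [Hconn Hroot]].
  set (W := {i : I | act i}).
  set (adjH := fun v w : W => v <> w /\ touch (K (proj1_sig v)) (K (proj1_sig w))).
  assert (Hinj : forall v w : W, v <> w -> proj1_sig v <> proj1_sig w).
  { intros [v Hv] [w Hw] N E. simpl in E. subst w. apply N. f_equal. apply proof_irrelevance. }
  destruct (@minors_colourable W adjH (fun w => K (proj1_sig w)))
    as [R [_ [_ [Htot [_ Hfin]]]]].
  - split; [split|split; [|split]].
    + intros v w [N H]. split; [auto|]. apply touch_sym. assumption.
    + intros v [N _]. auto.
    + intros v w x N. apply (Hdisj _ _ x (proj2_sig v) (proj2_sig w)). auto.
    + intros w. apply Hconn. apply proj2_sig.
    + intros v w [_ [x [y H]]]. eauto.
  - intros w. apply Hroot. apply proj2_sig.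
  - exists (fun i j => exists (Hi : act i) (Hj : act j),
      adjH (exist _ j Hj) (exist _ i Hi) /\ R (exist _ j Hj) (exist _ i Hi)).
    split.
    + intros i. destruct (classic (act i)) as [Hi|N].
      * destruct (Hfin (exist _ i Hi)) as [l Hl]. exists (map (@proj1_sig _ _) l).
        intros j [Hi' [Hj [H1 H2]]]. rewrite (proof_irrelevance _ Hi' Hi) in H1, H2.
        apply in_map_iff. exists (exist _ j Hj). auto.
      * exists nil. intros j [Hi _]. contradiction.
    + intros i j Hi Hj N Ht.
      destruct (Htot (exist _ i Hi) (exist _ j Hj)) as [H|[E|H]].
      * right. exists Hj, Hi. split; [split|assumption]; [|exact Ht].
        intros E. injection E as E. contradiction.
      * injection E as E. contradiction.
      * left. exists Hi, Hj. split; [split|assumption]; [|exact (touch_sym Ht)].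
        intros E. injection E as E. subst j. contradiction.
Qed.

Definition inf_nbrs (M D : V -> Prop) : Prop :=
  ~ fin (fun v => M v /\ exists d, D d /\ adj v d).

(* Give every vertex of [M] with uncountably many neighbouring [K i] one of them as a private
   root; an orientation of the resulting minor bounds the number of the remaining ones. *)
Lemma barricade (M : V -> Prop) (I : Type) (F : I -> Prop) (K : I -> V -> Prop) :
  countable M -> rooted_family F K ->
  (forall i v, F i -> K i v -> ~ M v) -> (forall i, F i -> inf_nbrs M (K i)) ->
  countable F.
Proof.
  intros [g Hg] [Hdisj [Hconn Hroot]] Hoff Hinf.
  assert (HM : countable M) by (exists g; exact Hg).
  set (N := fun x i => F i /\ touch (eq x) (K i)).
  set (heavy := fun x => M x /\ ~ countable (N x)).
  destruct (classic (exists i, F i)) as [[i0 _]|NF];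
    [|exists (fun _ => 0); intros x y Fx; exfalso; eauto].
  (* Private sets are chosen along the codes of the vertices: infinitely many candidates face
     finitely many earlier choices. The index [i0] is a default for numbers coding no heavy
     vertex. *)
  destruct (@wf_choice nat I lt lt_wf i0 (fun n f b => forall x, heavy x -> g x = n ->
      N x b /\ forall m, m < n -> b <> f m)) as [a Ha].
  { intros n f. destruct (classic (exists x, heavy x /\ g x = n)) as [[x [Hx Ex]]|Nx].
    - destruct (@not_fin_ex _ (N x) (fun i => In i (map f (seq 0 n)))) as [b [Nb Hb]].
      + intros Hf. apply Hx. apply countable_fin. assumption.
      + eexists. eauto.
      + exists b. intros y Hy Ey. replace y with x.
        * split; [assumption|]. intros m Hm ->. apply Hb. apply in_map. apply in_seq. lia.
        * apply Hg; [apply Hx|apply Hy|congruence].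
    - exists i0. intros x Hx Ex. exfalso. eauto. }
  set (al := fun x => a (g x)).
  assert (Hal : forall x, heavy x -> N x (al x)) by (intros x Hx; apply (Ha (g x)); auto).
  assert (Hal_lt : forall x y, heavy x -> heavy y -> g x < g y -> al y <> al x).
  { intros x y Hx Hy Hlt. destruct (Ha (g y) y Hy eq_refl) as [_ H].
    specialize (H (g x) Hlt).
    destruct (excluded_middle_informative (g x < g y)); [exact H|contradiction]. }
  assert (Hal_inj : forall x y, heavy x -> heavy y -> x <> y -> al x <> al y).
  { intros x y Hx Hy Nxy E. destruct (Nat.lt_trichotomy (g x) (g y)) as [H|[H|H]].
    - exact (Hal_lt x y Hx Hy H (eq_sym E)).
    - apply Nxy. apply Hg; [apply Hx|apply Hy|exact H].
    - exact (Hal_lt y x Hy Hx H E). }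
  set (act := fun s : V + I => match s with
    | inl x => heavy x
    | inr i => F i /\ forall x, heavy x -> al x <> i end).
  set (X := fun s : V + I => match s with
    | inl x => fun v => x = v \/ K (al x) v
    | inr i => K i end).
  destruct (@orientation _ act X) as [p [Hp1 Hp2]].
  { split; [|split].
    - intros [x|i] [y|j] v; simpl.
      + intros Hx Hy Nxy Hv Hv'.
        assert (x <> y) as Nxy' by congruence.
        destruct Hv as [<-|Hv], Hv' as [Ev|Hv'].
        * congruence.
        * apply (Hoff (al y) x); [apply Hal; assumption|assumption|apply Hx].
        * subst v. apply (Hoff (al x) y); [apply Hal; assumption|assumption|apply Hy].
        * apply (Hdisj (al x) (al y) v); auto; apply Hal; assumption.
      + intros Hx [Fj Hj] _ [<-|Hv] Hv'.
        * apply (Hoff j x); auto. apply Hx.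
        * apply (Hdisj (al x) j v); auto. apply Hal; assumption.
      + intros [Fi Hi] Hy _ Hv [<-|Hv'].
        * apply (Hoff i y); auto. apply Hy.
        * apply (Hdisj i (al y) v); auto; [apply Hal; assumption|].
          intros E. exact (Hi y Hy (eq_sym E)).
      + intros [Fi _] [Fj _] Nij Hv Hv'. apply (Hdisj i j v); auto. congruence.
    - intros [x|i]; simpl.
      + intros Hx. apply connected_or.
        * apply connected_single.
        * apply Hconn. apply Hal. assumption.
        * apply Hal. assumption.
      + intros [Fi _]. auto.
    - intros [x|i]; simpl.
      + intros Hx. destruct (Hroot (al x)) as [u Hu]; [apply Hal; assumption|].
        exists u. tauto.
      + intros [Fi _]. auto. }
  (* Countably many indices have a neighbour that is not heavy, serve as a private set, or receive
     an edge oriented from a vertex of [M]. Any other index would send an edge to each of its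
     infinitely many neighbours in [M]. *)
  apply countable_sub with (T := fun i =>
    ((exists x, (M x /\ countable (N x)) /\ N x i) \/ (exists x, M x /\ al x = i)) \/
    (exists x, M x /\ exists s, p (inl x) s /\ s = inr i)).
  - apply countable_or; [apply countable_or|].
    + apply countable_union; [apply (countable_sub HM); tauto|]. tauto.
    + apply countable_image. assumption.
    + apply countable_union; [assumption|]. intros x _.
      apply countable_union; [apply countable_fin; apply Hp1|].
      intros s _. exists (fun _ => 0). intros; congruence.
  - intros i Fi. apply NNPP. intros Ni.
    assert (Hi : act (inr i)).
    { simpl. split; [assumption|]. intros x Hx E. apply Ni. left. right.
      exists x. split; [apply Hx|assumption]. }
    apply (Hinf i Fi).
    assert (Hf : fin (fun x => p (inr i) (inl x))).
    { destruct (Hp1 (inr i)) as [l Hl].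
      exists (flat_map (fun s => match s with inl x => [x] | inr _ => [] end) l).
      intros x Hx. apply in_flat_map. exists (inl x). simpl. auto. }
    apply (fin_sub Hf). intros x [Mx [d [Kd Hxd]]].
    assert (Nxi : N x i) by (split; [assumption|]; exists x, d; auto).
    assert (Hx : heavy x) by (split; [assumption|]; intros Hc; apply Ni; left; left; eauto).
    destruct (@Hp2 (inl x) (inr i)) as [H|H]; auto.
    + congruence.
    + exists x, d. simpl. auto.
    + exfalso. apply Ni. right. eauto.
Qed.

(** * A partition of a superset of [U] into countable connected sets *)

Variable lt : V -> V -> Prop.
Hypothesis Hwo : well_order lt.

Let lt_irr : forall x, ~ lt x x := proj1 Hwo.
Let lt_trans : forall x y z, lt x y -> lt y z -> lt x z := proj1 (proj2 Hwo).
Let lt_total : forall x y, lt x y \/ x = y \/ lt y x := proj1 (proj2 (proj2 Hwo)).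
Let lt_wf : well_founded lt := proj2 (proj2 (proj2 Hwo)).

Definition before (K : V -> V -> Prop) (u v : V) : Prop := exists w, lt w u /\ K w v.

Definition active (K : V -> V -> Prop) (u : V) : Prop := U u /\ ~ before K u u.

Definition region (K : V -> V -> Prop) (u : V) : V -> Prop :=
  reach (fun v => ~ before K u v) u.

(* The last two clauses reflect that infinitely many neighbours of [region K u] either meet
   infinitely many earlier sets or are infinitely many in a single one. *)
Definition branch_at (K : V -> V -> Prop) (u : V) (S : V -> Prop) : Prop :=
  (~ active K u -> forall v, ~ S v) /\
  (active K u ->
    countable S /\ connected_in adj S /\ S u /\ (forall v, S v -> region K u v) /\
    (~ fin (fun w => lt w u /\ touch (K w) (region K u)) ->
      ~ fin (fun w => lt w u /\ touch (K w) S)) /\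
    ((exists w, lt w u /\ inf_nbrs (K w) (region K u)) ->
      exists w, lt w u /\ inf_nbrs (K w) S)).

(** Only earlier values of [K] matter, so the truncated family of [wf_choice] can be replaced by the
    full one. *)
Lemma branch_at_ext (K K' : V -> V -> Prop) u S :
  (forall w, lt w u -> K w = K' w) -> branch_at K u S -> branch_at K' u S.
Proof.
  intros H.
  assert (E1 : before K u = before K' u).
  { apply functional_extensionality. intros v. apply propositional_extensionality.
    split; intros [w [Hw Hv]]; exists w; split; auto; [rewrite <- H|rewrite H]; auto. }
  assert (E2 : forall D, (fun w => lt w u /\ touch (K w) D) = (fun w => lt w u /\ touch (K' w) D)).
  { intros D. apply functional_extensionality. intros w. apply propositional_extensionality.
    split; intros [Hw Hv]; split; auto; [rewrite <- H|rewrite H]; auto. }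
  assert (E3 : forall D,
    (exists w, lt w u /\ inf_nbrs (K w) D) = (exists w, lt w u /\ inf_nbrs (K' w) D)).
  { intros D. apply propositional_extensionality.
    split; intros [w [Hw Hv]]; exists w; split; auto; [rewrite <- H|rewrite H]; auto. }
  unfold branch_at, active, region. rewrite E1, !E2, !E3. auto.
Qed.

Lemma branch_at_exists (K : V -> V -> Prop) u : exists S, branch_at K u S.
Proof.
  destruct (classic (active K u)) as [Ha|Na];
    [|exists (fun _ => False); split; [auto|contradiction]].
  set (D := region K u).
  assert (HD : connected_in adj D) by (apply connected_comp; apply Ha).
  (* Each of the two clauses on neighbours is secured by a countable set of witnesses in [D], empty
     if the premise of the clause fails; [S] is a countable connected set containing both. *)
  assert (H1 : exists Q, countable Q /\ (forall d, Q d -> D d) /\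
    (~ fin (fun w => lt w u /\ touch (K w) D) -> ~ fin (fun w => lt w u /\ touch (K w) Q))).
  { destruct (classic (fin (fun w => lt w u /\ touch (K w) D))) as [Hf|Hf].
    - exists (fun _ => False). split; [exists (fun _ => 0); tauto|]. tauto.
    - destruct (@infinite_capture V V D (fun w d => lt w u /\ exists k, K w k /\ adj k d))
        as [Q [Q1 [Q2 Q3]]].
      + intros Hf'. apply Hf. apply (fin_sub Hf').
        intros w [Hw [k [d [Hk [Hd Hkd]]]]]. exists d. eauto.
      + exists Q. split; [assumption|]. split; [assumption|]. intros _ Hf'. apply Q3.
        apply (fin_sub Hf'). intros w [d [Hd [Hw [k [Hk Hkd]]]]].
        split; [assumption|]. exists k, d. auto. }
  assert (H2 : exists Q, countable Q /\ (forall d, Q d -> D d) /\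
    ((exists w, lt w u /\ inf_nbrs (K w) D) -> exists w, lt w u /\ inf_nbrs (K w) Q)).
  { destruct (classic (exists w, lt w u /\ inf_nbrs (K w) D)) as [[w [Hw Hf]]|N].
    - destruct (@infinite_capture V V D (fun v d => K w v /\ adj v d))
        as [Q [Q1 [Q2 Q3]]].
      + intros Hf'. apply Hf. apply (fin_sub Hf').
        intros v [Hv [d [Hd Hvd]]]. eauto.
      + exists Q. split; [assumption|]. split; [assumption|]. intros _. exists w.
        split; [assumption|]. intros Hf'. apply Q3.
        apply (fin_sub Hf'). intros v [d [Hd [Hv Hvd]]]. eauto.
    - exists (fun _ => False). split; [exists (fun _ => 0); tauto|]. tauto. }
  destruct H1 as [Q [Q1 [Q2 Q3]]]. destruct H2 as [Q' [Q1' [Q2' Q3']]].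
  destruct (@countable_capture D (fun v => Q v \/ Q' v) u HD) as [S [S1 [S2 [S3 [S4 S5]]]]].
  - apply rt_refl.
  - apply countable_or; assumption.
  - intros v [Hv|Hv]; auto.
  - exists S. split; [contradiction|]. intros _.
    split; [assumption|]. split; [assumption|]. split; [assumption|]. split; [assumption|].
    split.
    + intros Hf Hf'. apply (Q3 Hf). apply (fin_sub Hf').
      intros w [Hw [k [d [Hk [Hd Hkd]]]]]. split; [assumption|]. exists k, d. auto.
    + intros H. destruct (Q3' H) as [w [Hw Hf]]. exists w. split; [assumption|].
      intros Hf'. apply Hf. apply (fin_sub Hf').
      intros v [Hv [d [Hd Hvd]]]. split; [assumption|]. exists d. auto.
Qed.

Lemma branches_exist : exists K : V -> V -> Prop, forall u, branch_at K u (K u).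
Proof.
  destruct (@wf_choice V (V -> Prop) lt lt_wf (fun _ => False) (fun u K S => branch_at K u S))
    as [K HK].
  - intros u K. apply branch_at_exists.
  - exists K. intros u. refine (branch_at_ext _ (HK u)).
    intros w Hw. simpl. destruct (excluded_middle_informative (lt w u)); [reflexivity|contradiction].
Qed.

Section Branches.
Variable K : V -> V -> Prop.
Hypothesis HK : forall u, branch_at K u (K u).

Let act := active K.
Let D := region K.

Lemma branch_active u v : K u v -> act u.
Proof. intros Hv. apply NNPP. intros N. exact (proj1 (HK u) N v Hv). Qed.

Lemma branch_countable u : countable (K u).
Proof.
  destruct (classic (act u)) as [Ha|N].
  - apply (proj2 (HK u) Ha).
  - exists (fun _ => 0). intros v w Hv. exfalso. exact (proj1 (HK u) N v Hv).
Qed.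

Lemma branch_connected u : act u -> connected_in adj (K u).
Proof. intros Ha. apply (proj2 (HK u) Ha). Qed.

Lemma branch_self u : act u -> K u u.
Proof. intros Ha. apply (proj2 (HK u) Ha). Qed.

Lemma branch_region u v : K u v -> D u v.
Proof. intros Hv. apply (proj2 (HK u) (branch_active Hv)). exact Hv. Qed.

Lemma region_self u : D u u.
Proof. apply rt_refl. Qed.

Lemma region_off u v : act u -> D u v -> ~ before K u v.
Proof. intros [_ Ha] Hv. exact (reach_in Hv Ha). Qed.

Lemma region_connected u : act u -> connected_in adj (D u).
Proof. intros [_ Ha]. apply connected_comp. exact Ha. Qed.

Lemma branch_disjoint i j x : i <> j -> K i x -> K j x -> False.
Proof.
  intros N Hi Hj. destruct (lt_total i j) as [H|[H|H]]; [|contradiction|].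
  - apply (region_off (branch_active Hj) (branch_region Hj)). exists i. auto.
  - apply (region_off (branch_active Hi) (branch_region Hi)). exists j. auto.
Qed.

Lemma branch_cover u : U u -> exists w, K w u.
Proof.
  intros Hu. destruct (classic (before K u u)) as [[w [_ H]]|N]; [eauto|].
  exists u. apply branch_self. split; assumption.
Qed.

Lemma branch_rooted : rooted_family act K.
Proof.
  split; [|split].
  - intros i j x _ _. apply branch_disjoint.
  - exact branch_connected.
  - intros i Hi. exists i. split; [apply Hi|apply branch_self; assumption].
Qed.

Definition below (w u : V) : Prop := act w /\ act u /\ lt w u /\ D w u.

Lemma before_mono w u v : lt w u -> before K w v -> before K u v.
Proof. intros H [t [Ht Hv]]. exists t. eauto. Qed.

Lemma region_max u (C : V -> Prop) x z : connected_in adj C ->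
  (forall v, C v -> ~ before K u v) -> C x -> D u x -> C z -> D u z.
Proof. intros HC Hoff Cx Dx Cz. exact (connected_sub_comp HC Hoff Cx Dx Cz). Qed.

Lemma region_sub w u v : below w u -> D u v -> D w v.
Proof.
  intros [Hw [Hu [Hlt Hwu]]] Hv.
  apply (@region_max w (D u) u v); auto.
  - apply region_connected. assumption.
  - intros x Hx Hb. apply (region_off Hu Hx). exact (before_mono Hlt Hb).
  - apply region_self.
Qed.

Lemma below_trans w u v : below w u -> below u v -> below w v.
Proof.
  intros H1 H2. split; [apply H1|]. split; [apply H2|]. split.
  - apply lt_trans with u; [apply H1|apply H2].
  - apply (region_sub H1). apply H2.
Qed.

(** [D w] is connected, avoids all sets before [v], and meets [D v] in [u], so it is contained in
    [D v]. *)
Lemma below_chain v w u : below v u -> below w u -> lt v w -> below v w.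
Proof.
  intros [Hv [Hu [Hvu Dvu]]] [Hw [_ [Hwu Dwu]]] Hvw.
  split; [assumption|]. split; [assumption|]. split; [assumption|].
  apply (@region_max v (D w) u w); auto.
  - apply region_connected. assumption.
  - intros x Hx Hb. apply (region_off Hw Hx). exact (before_mono Hvw Hb).
  - apply region_self.
Qed.

(** The union of [K w] and [D u] is connected and avoids all sets before [w], hence lies in
    [D w]. *)
Lemma touch_below w u : act u -> lt w u -> touch (K w) (D u) -> below w u.
Proof.
  intros Hu Hlt Ht. destruct Ht as [k [d [Hk [Hd Hkd]]]].
  assert (Hw : act w) by exact (branch_active Hk).
  split; [assumption|]. split; [assumption|]. split; [assumption|].
  apply (@region_max w (fun v => K w v \/ D u v) w u).
  - apply connected_or; [apply branch_connected; assumption|apply region_connected; assumption|].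
    exists k, d. auto.
  - intros x [Hx|Hx] Hb.
    + exact (region_off Hw (branch_region Hx) Hb).
    + apply (region_off Hu Hx). exact (before_mono Hlt Hb).
  - left. apply branch_self. assumption.
  - apply region_self.
  - right. apply region_self.
Qed.

Lemma touch_branch_region w u : touch (K w) (K u) -> touch (K w) (D u).
Proof.
  intros [k [d [Hk [Hd Hkd]]]]. exists k, d. split; [assumption|].
  split; [exact (branch_region Hd)|assumption].
Qed.

(** * Chains, closed sets of indices and finite adhesion *)

Variable p : V -> V -> Prop.
Hypothesis p_fin : forall u, fin (p u).
Hypothesis p_orients : forall i j, act i -> act j -> i <> j -> touch (K i) (K j) ->
  p i j \/ p j i.

(** By the choice of [K u], it touches infinitely many earlier sets itself. Only finitely many of
    these edges are oriented out of [u]. *)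
Lemma infinite_back u : act u -> ~ fin (fun w => lt w u /\ touch (K w) (D u)) ->
  exists w, below w u /\ p w u.
Proof.
  intros Hu Hf. destruct (proj2 (HK u) Hu) as [_ [_ [_ [_ [Hf' _]]]]].
  destruct (not_fin_ex (Hf' Hf) (p_fin u)) as [w [[Hw Ht] Np]].
  assert (Hb : below w u) by (apply touch_below; auto using touch_branch_region).
  exists w. split; [assumption|].
  destruct (@p_orients w u) as [H|H]; auto; [apply Hb|..].
  - intros ->. exact (lt_irr Hw).
  - contradiction.
Qed.

(* A chain of type [omega_1] would have a countable limit stage closed under [p], and the
   active set at that stage would violate [infinite_back]. *)
Lemma chain_countable y : countable (fun w => below w y).
Proof.
  apply NNPP. intros Ny.
  (* By minimality of [y0], every proper initial segment of the uncountable chain [P] is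
     countable. *)
  destruct (@wf_min V lt lt_wf (fun y => ~ countable (fun w => below w y)))
    as [y0 [Hunc Hmin]]; [eauto|]. clear y Ny.
  set (P := fun w => below w y0).
  assert (Hcnt : forall z, P z -> countable (fun w => below w z)).
  { intros z Hz. apply NNPP. apply Hmin. apply Hz. }
  assert (Hnx : forall w, exists w', P w -> P w' /\ lt w w').
  { intros w. apply NNPP. intros N. apply Hunc.
    apply countable_sub with (T := fun v => below v w \/ w = v).
    - apply countable_or; [|apply countable_single]. apply Hcnt.
      apply NNPP. intros Nw. apply N. exists w. tauto.
    - intros v Hv. destruct (classic (P w)) as [Pw|Nw]; [|exfalso; apply N; exists w; tauto].
      destruct (lt_total v w) as [H|[H|H]]; auto.
      + left. exact (below_chain Hv Pw H).
      + exfalso. apply N. exists v. auto. }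
  destruct (choice _ Hnx) as [nx Hnx']. clear Hnx.
  set (c := fun x v => P x /\ P v /\ (below v x \/ p x v \/ nx x = v)).
  assert (Hc : forall x, countable (c x)).
  { intros x. destruct (classic (P x)) as [Px|N].
    - apply countable_sub with (T := fun v => below v x \/ (p x v \/ nx x = v)).
      + apply countable_or; [auto|]. apply countable_or; [|apply countable_single].
        apply countable_fin. apply p_fin.
      + intros v [_ [_ H]]. exact H.
    - exists (fun _ => 0). intros v w [Px _]. contradiction. }
  destruct (classic (exists w, P w)) as [[w0 Pw0]|N];
    [|apply Hunc; exists (fun _ => 0); intros v w Hv; exfalso; eauto].
  set (A := clos_refl_trans V c w0).
  assert (HA : countable A) by (apply countable_closure; assumption).
  assert (AP : forall v, A v -> P v).
  { intros v Hv. apply clos_rt_rtn1 in Hv. induction Hv as [|v v' H _ _]; [assumption|apply H]. }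
  assert (Ac : forall v v', A v -> c v v' -> A v').
  { intros v v' Hv H. eapply rt_trans; [exact Hv|]. apply rt_step. exact H. }
  (* Closure under [below] makes [A] an initial segment of [P]: it consists of the elements of [P]
     before [z]. Closure under [nx] leaves it without a last element. *)
  destruct (@wf_min V lt lt_wf (fun z => P z /\ ~ A z)) as [z [[Pz Az] Hz]].
  { apply NNPP. intros N. apply Hunc. apply (countable_sub HA). intros v Hv.
    apply NNPP. intros Nv. eauto. }
  assert (A_lt : forall v, A v -> lt v z).
  { intros v Hv. destruct (lt_total v z) as [H|[H|H]]; [assumption|subst v; contradiction|].
    exfalso. apply Az. apply (Ac v z Hv). split; [auto|]. split; [assumption|].
    left. exact (below_chain Pz (AP v Hv) H). }
  assert (lt_A : forall v, P v -> lt v z -> A v).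
  { intros v Hv Hlt. apply NNPP. intros N. apply (Hz v Hlt). auto. }
  assert (Hact : act z) by apply Pz.
  assert (below_A : forall v, below v z -> A v).
  { intros v Hv. apply lt_A; [exact (below_trans Hv Pz)|apply Hv]. }
  (* [D w] contains both [w] and [D z], while [w] lies outside [D z]. An edge inside [D w] leaving
     [D z] ends in some earlier set, whose index cannot precede [w]. *)
  assert (Hkey : forall w, A w ->
    exists w', (lt w' z /\ touch (K w') (D z)) /\ (w' = w \/ lt w w')).
  { intros w Aw. assert (Hwz : below w z) by exact (below_chain (AP w Aw) Pz (A_lt w Aw)).
    assert (Kw : K w w) by (apply branch_self; apply Hwz).
    destruct (region_connected (proj1 Hwz)) as [_ Hr].
    destruct (@crossing (D w) (D z) z w) as [a [b [Da [Db [Hab [Ha Hb]]]]]].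
    - apply Hr; [apply Hwz|apply region_self].
    - apply region_self.
    - intros H. apply (region_off Hact H). exists w. split; [apply Hwz|assumption].
    - assert (Hbz : before K z b).
      { apply NNPP. intros N. apply Hb. apply reach_step with a; auto. apply Hact. }
      destruct Hbz as [w' [Hw' Hb']]. exists w'. split.
      + split; [assumption|]. exists b, a. auto.
      + destruct (lt_total w w') as [H|[H|H]]; auto. exfalso.
        apply (region_off (proj1 Hwz) Db). exists w'. auto. }
  (* The touching indices are unbounded in [A], hence infinite in number. The resulting edge
     oriented from [A] to [z] puts [z] into [A], a contradiction. *)
  destruct (@infinite_back z Hact) as [w [Hw Hp]].
  - apply no_max_not_fin with (lt := lt); [assumption| |].
    + destruct (Hkey w0 (rt_refl _ _ _)) as [w' [H _]]. eauto.
    + intros x [Hx Ht].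
      assert (Ax : A x) by (apply below_A; apply touch_below; auto).
      destruct (Hnx' x (AP x Ax)) as [Pn Hn].
      destruct (Hkey (nx x)) as [w' [H Hw']].
      * apply (Ac x); [assumption|]. split; [auto|]. split; [assumption|]. auto.
      * exists w'. split; [assumption|]. destruct Hw' as [-> |Hw']; [assumption|].
        exact (lt_trans Hn Hw').
  - apply Az. apply (Ac w); [auto|]. split; [auto|]. split; [assumption|]. auto.
Qed.

(** The alternatives exclude in turn that an index outside a closed set is below a member, receives
    an oriented edge from it, or comes later and has infinitely many neighbours in its branch
    set. *)
Definition pull (u v : V) : Prop :=
  act v /\ (below v u \/ p u v \/ (lt u v /\ inf_nbrs (K u) (K v))).

Lemma pull_countable u : countable (pull u).
Proof.
  apply countable_sub with (T := fun v => below v u \/ (p u v \/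
    (act v /\ lt u v /\ inf_nbrs (K u) (K v)))).
  - apply countable_or; [apply chain_countable|].
    apply countable_or; [apply countable_fin; apply p_fin|].
    destruct branch_rooted as [_ [R2 R3]].
    apply barricade with (M := K u) (K := K).
    + apply branch_countable.
    + split; [intros i j x _ _; apply branch_disjoint|].
      split; [intros i [Hi _]; auto|intros i [Hi _]; auto].
    + intros i v [_ [Hi _]] Hv Hv'. apply (@branch_disjoint i u v); auto.
      intros ->. exact (lt_irr Hi).
    + intros i [_ [_ Hi]]. assumption.
  - intros v [Hv [H|[H|H]]]; auto.
Qed.

Lemma closed_finite_adhesion (A C : V -> Prop) :
  (forall a, A a -> act a) -> (forall a b, A a -> pull a b -> A b) ->
  connected_in adj C -> (forall a v, A a -> K a v -> ~ C v) ->
  (exists w v, K w v /\ C v) ->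
  fin (fun s => (exists a, A a /\ K a s) /\ exists d, C d /\ adj s d).
Proof.
  intros Aact Acl HC Hoff [w0 [v0 [Hw0 Hv0]]].
  (* The first index whose set meets [C] has these properties, since [C] avoids all earlier sets. *)
  assert (H : exists i, act i /\ ~ A i /\ forall v, C v -> D i v).
  { destruct (@wf_min V lt lt_wf (fun w => exists v, K w v /\ C v)) as [i [[v [Hv Cv]] Hmin]];
      [eauto|].
    exists i. split; [exact (branch_active Hv)|]. split; [intros Ai; exact (Hoff i v Ai Hv Cv)|].
    intros x Cx. apply (@region_max i C v x); auto using branch_region.
    intros y Cy [w [Hw Hy]]. apply (Hmin w Hw). eauto. }
  destruct (wf_min lt_wf H) as [i [[Hi [NAi HCi]] Hmin]]. clear H.
  assert (below_A : forall w, below w i -> A w).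
  { intros w Hw. apply NNPP. intros N. apply (Hmin w); [apply Hw|].
    split; [apply Hw|]. split; [assumption|]. intros v Cv. apply (region_sub Hw). auto. }
  (* It suffices that only finitely many earlier sets touch [D i], and that each contains only
     finitely many neighbours of [D i]. *)
  apply fin_sub with (T := fun s => exists a, (lt a i /\ touch (K a) (D i)) /\
    (K a s /\ exists d, D i d /\ adj s d)).
  - apply fin_union.
    + apply NNPP. intros Hf. destruct (infinite_back Hi Hf) as [w [Hw Hp]].
      apply NAi. apply (Acl w); [auto|]. split; auto.
    (* By the last clause of [branch_at], a failure for [a] yields some [w], possibly different from
       [a], with infinitely many vertices of [K w] adjacent to [K i]. This [w] is below [i] and so
       pulls [i] into [A]. *)
    + intros a [Ha Ht]. apply NNPP. intros Hf.
      destruct (proj2 (HK i) Hi) as [_ [_ [_ [_ [_ H]]]]].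
      destruct H as [w [Hw Hinf]]; [exists a; split; assumption|].
      apply NAi. apply (Acl w); [|split; auto].
      apply below_A. apply touch_below; [assumption|assumption|].
      destruct (@not_fin_ex _ _ (fun _ => False) Hinf) as [k [[Hk [d [Hd Hkd]]] _]];
        [exists nil; auto|].
      apply touch_branch_region. exists k, d. auto.
  - intros s [[a [Aa Ha]] [d [Cd Hsd]]]. exists a.
    assert (Ht : touch (K a) (D i)) by (exists s, d; auto).
    split; [|eauto]. split; [|assumption].
    destruct (lt_total a i) as [H|[H|H]]; [assumption|subst a; contradiction|].
    (* If [i] precedes [a], then [K a] touches [D i] and avoids all sets before [i]. So [i] is below
       [a] and would belong to [A]. *)
    exfalso. apply NAi. apply (Acl a); [assumption|]. split; [assumption|]. left.
    assert (Hact : act a) by auto.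
    split; [assumption|]. split; [assumption|]. split; [assumption|].
    apply (@region_max i (fun v => K a v \/ D i v) i a).
    + apply connected_or; [apply branch_connected|apply region_connected|]; assumption.
    + intros x [Hx|Hx] Hb.
      * apply (region_off Hact (branch_region Hx)). exact (before_mono H Hb).
      * exact (region_off Hi Hx Hb).
    + right. apply region_self.
    + apply region_self.
    + left. apply branch_self. assumption.
Qed.

End Branches.

(** * A well-order along closed sets of indices *)

Lemma adhesion_order_exists :
  exists X R, (forall u, U u -> X u) /\ adhesion_order X R.
Proof.
  destruct branches_exist as [K HK].
  destruct (orientation (branch_rooted HK)) as [p [Hp1 Hp2]].
  set (c := pull K p).
  (* [B i] is the union of the branch sets over the closed set generated by [i]. Being countable, it
     is enumerated by [code i]. *)
  set (B := fun i v => exists j, clos_refl_trans V c i j /\ K j v).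
  assert (HB : forall i, exists code : V -> nat,
      forall x y, B i x -> B i y -> code x = code y -> x = y).
  { intros i. apply countable_union.
    - apply countable_closure. intros u. apply (pull_countable HK Hp1 Hp2).
    - intros j _. apply (branch_countable HK). }
  destruct (choice _ HB) as [code Hcode].
  set (X := fun v => exists i, B i v).
  assert (Hb : forall v, exists i, X v -> B i v /\ forall j, lt j i -> ~ B j v).
  { intros v. destruct (classic (X v)) as [Xv|N]; [|exists v; tauto].
    destruct (wf_min lt_wf Xv) as [i Hi]. eauto. }
  destruct (choice _ Hb) as [b Hb']. clear Hb. rename Hb' into Hb.
  set (n := fun v => code (b v) v).
  (* Vertices are ordered by the first stage [b] covering them, and within a stage by their code, so
     each has only finitely many predecessors of its own stage. *)
  set (R := fun x y => lt (b x) (b y) \/ (b x = b y /\ n x < n y)).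
  exists X, R. split; [|split; [|split; [|split]]].
  - intros u Hu. destruct (branch_cover HK Hu) as [w Hw]. exists w, w.
    split; [apply rt_refl|assumption].
  - apply lex_wf; [assumption|exact Wf_nat.lt_wf].
  - intros x y z [H1|[E1 H1]] [H2|[E2 H2]].
    + left. eauto.
    + left. congruence.
    + left. congruence.
    + right. split; [congruence|lia].
  - intros x y Hx Hy. destruct (lt_total (b x) (b y)) as [H|[E|H]].
    + left. left. assumption.
    + destruct (Nat.lt_trichotomy (n x) (n y)) as [H|[H|H]].
      * left. right. auto.
      * right. left. apply (Hcode (b x)).
        -- apply Hb. assumption.
        -- rewrite E. apply Hb. assumption.
        -- unfold n in H. rewrite <- E in H. exact H.
      * right. right. right. auto.
    + right. right. left. assumption.
  - intros x C Hx HC Cx Hoff.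
    (* [A] collects the closed sets of all stages before that of [x]; a union of closed sets is
       closed. *)
    set (A := fun j => active K j /\ exists i, lt i (b x) /\ clos_refl_trans V c i j).
    assert (HAX : forall a v, A a -> K a v -> X v /\ R v x).
    { intros a v [_ [i [Hi Hia]]] Hv. assert (Biv : B i v) by (exists a; auto).
      assert (Xv : X v) by (exists i; assumption). split; [assumption|].
      left. destruct (Hb v Xv) as [_ Hmin].
      destruct (lt_total (b v) i) as [H|[H|H]]; [eauto|congruence|].
      exfalso. exact (Hmin i H Biv). }
    destruct (Hb x Hx) as [Bx _].
    (* A vertex before [x] either belongs to an earlier stage, and so to the union over [A], or is
       one of the finitely many of smaller code in the stage of [x]. *)
    apply fin_sub with (T := fun s =>
      ((exists a, A a /\ K a s) /\ exists d, C d /\ adj s d) \/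
      (B (b x) s /\ code (b x) s < n x)).
    + apply fin_or; [|apply fin_bounded_code; apply Hcode].
      apply (closed_finite_adhesion HK Hp1 Hp2); auto.
      * intros a [Ha _]. assumption.
      * intros a a' [_ [i [Hi Hia]]] Haa'. split; [apply Haa'|]. exists i.
        split; [assumption|]. eapply rt_trans; [exact Hia|]. apply rt_step. assumption.
      * intros a v Aa Hv Cv. destruct (HAX a v Aa Hv) as [Xv Rv]. exact (Hoff v Cv Xv Rv).
      * destruct Bx as [j [_ Hj]]. eauto.
    + intros s [[Xs [Hs|[Es Hs]]] Hd]; destruct (Hb s Xs) as [[j [Hj Kj]] _].
      * left. split; [|assumption]. exists j. split; [|assumption].
        split; [exact (branch_active HK Kj)|]. eauto.
      * right. rewrite <- Es. split; [exists j; auto|]. unfold n in Hs. rewrite Es in Hs |- *.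
        exact Hs.
Qed.

End Connected.

Theorem theorem1p2 (V : Type) (adj : V -> V -> Prop)
    (HG : simple_graph adj) (Hconn : graph_connected adj) (U : V -> Prop) :
  normally_spanned adj U <->
  (forall (W : Type) (adjH : W -> W -> Prop) (X : W -> V -> Prop),
      is_minor adj adjH X -> U_rooted U X -> countable_colouring_number adjH).
Proof.
  destruct HG as [Hsym Hirr]. split.
  - intros [VT [ET [r [HT HU]]]] W adjH X Hminor Hroot.
    destruct (root_path_exists HT) as [down Hdown].
    apply (normal_tree_colouring Hsym Hirr HT Hdown Hminor).
    intros w. destruct (Hroot w) as [u [Hu Xu]]. eauto.
  - intros Hmin. destruct (zermelo V) as [lt Hlt].
    destruct (adhesion_order_exists Hsym Hmin Hlt) as [X [R [HUX HR]]].
    (* Any vertex can serve as the root; connectedness includes that there is one. *)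
    destruct (proj1 Hconn) as [r _].
    destruct (adhesion_order_tree Hsym Hconn r HR) as [par [Hpar HX]].
    exists (verts r par), (fun x y => par x y \/ par y x), r.
    split; [|auto]. apply parent_tree_normal; assumption.
Qed.
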